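(* Let $P(z)$ be a polynomial over $\mathbb{K}$ having only simple zeros, and let $t$ and $t'$ be the numbers attached to $P$ as defined in the context. (a) If $t\ge 1$ and $t'\ge 5$, then $P(z)$ is a UPM in $\mathbb{K}$. (b) If $t\ge 1$ and $t'\ge 4$, then $P(z)$ is a UPE in $\mathbb{K}$.
   Context: $\mathbb{K}$ is an algebraically closed field of characteristic zero, complete for a non-Archimedean absolute value. $\mathcal{A}(\mathbb{K})$ and $\mathcal{M}(\mathbb{K})$ denote the ring of entire functions and the field of meromorphic functions in $\mathbb{K}$. A non-constant polynomial $P$ is a UPM (resp. UPE) in $\mathbb{K}$ if for any two non-constant $f,g\in\mathcal{M}(\mathbb{K})$ (resp. $f,g\in\mathcal{A}(\mathbb{K})$), the identity $P(f)=P(g)$ implies $f=g$. Definition of $t,t'$. Let $S$ be the set of distinct zeros of $P'$, and for $d\in S$ let $q_d\ge 1$ be the multiplicity of $d$ as a zero of $P'$. Partition $S$ into ''columns'' $C_1,C_2,\dots$, namely the classes of the equivalence relation $d\sim d'\iff P(d)=P(d')$. Let $C_i'$ be the list (with repetitions) of the multiplicities $q_d$, $d\in C_i$. Let $A_i$ be the set of values that occur exactly once in the list $C_i'$. Put $A_i(H_1)=\{q\in A_i: q>q' \text{ for all } q' \text{ in } C_i' \text{ with } q'\notin A_i\}$, $A_i(H_2)=\{q\in A_i(H_1): \max A_i(H_1)+1<2(q+1)\}$, $B_i(H_2)=\{d\in C_i: q_d\in A_i(H_2)\}$. Then $t=|\{i: B_i(H_2)\neq\emptyset\}|$ and $t'=|\bigcup_i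 B_i(H_2)|$. *)

(* Defs.v *)
From HB Require Import structures.
From mathcomp Require Import all_boot all_order all_algebra finmap.
From mathcomp Require Import all_classical all_reals all_analysis.
From mathcomp Require Import fraction.

Set Implicit Arguments.
Unset Strict Implicit.
Unset Printing Implicit Defensive.

Import Order.TTheory GRing.Theory Num.Theory.
Import numFieldNormedType.Exports.

Local Open Scope classical_set_scope.
Local Open Scope ring_scope.

Record nonarch_absval (R : realType) (K : fieldType) := NonarchAbsval {
  absval :> K -> R;
  absval_ge0 : forall x, 0 <= absval x;
  absval_eq0 : forall x, (absval x == 0) = (x == 0);
  absvalM : forall x y, absval (x * y) = absval x * absval y;
  absvalD : forall x y, absval (x + y) <= Num.max (absval x) (absval y) }.

Definition absval_complete (R : realType) (K : fieldType)
    (v : nonarch_absval R K) : Prop :=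
  forall u : nat -> K,
    (forall e : R, 0 < e ->
      exists N, forall m n, (N <= m)%N -> (N <= n)%N -> v (u m - u n) < e) ->
    exists l : K, (fun n => v (u n - l)) @ \oo --> (0 : R).

Section AbsvalTheory.
Variables (R : realType) (K : fieldType) (v : nonarch_absval R K).

Lemma absval0 : v 0 = 0.
Proof. by apply/eqP; rewrite absval_eq0. Qed.

Lemma absval1 : v 1 = 1.
Proof.
have v1 : v 1 != 0 by rewrite absval_eq0 oner_eq0.
by apply: (mulfI v1); rewrite -absvalM !mulr1.
Qed.

Lemma absvalN x : v (- x) = v x.
Proof.
have vN1 : v (-1) = 1.
  apply/eqP; rewrite -(@eqrXn2 _ 2) ?absval_ge0// expr1n expr2 -absvalM.
  by rewrite mulrNN mulr1 absval1.
by rewrite -mulN1r absvalM vN1 mul1r.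
Qed.

Lemma absval_sum_le (n : nat) (F : nat -> K) (M : R) : 0 <= M ->
  (forall i, (i < n)%N -> v (F i) <= M) -> v (\sum_(i < n) F i) <= M.
Proof.
move=> M0; elim: n => [|n IH] FM; first by rewrite big_ord0 absval0.
rewrite big_ord_recr /= (le_trans (absvalD _ _ _))// ge_max.
by rewrite IH ?FM// => i ni; rewrite FM// ltnW.
Qed.

End AbsvalTheory.

(* An entire function is a power series [\sum_n a n * z ^ n] over [K] of
   infinite radius of convergence, and is represented by its coefficients;
   entire functions form a ring for the Cauchy product. *)

Definition is_entire (R : realType) (K : fieldType) (v : nonarch_absval R K)
    (a : nat -> K) : Prop :=
  forall r : R, 0 < r -> (fun n => v (a n) * r ^+ n) @ \oo --> (0 : R).

Section Entire.
Variables (R : realType) (K : fieldType) (v : nonarch_absval R K).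

Record entire := Entire {
  coef :> nat -> K;
  coef_entire : `[< is_entire v coef >] }.

HB.instance Definition _ := [isSub for coef].
HB.instance Definition _ := [Choice of entire by <:].

Lemma entireP (f : entire) : is_entire v f.
Proof. exact/asboolP/coef_entire. Qed.

Definition mk_entire (a : nat -> K) (ha : is_entire v a) : entire :=
  @Entire a (introT (asboolP _) ha).

Lemma eq_entire (f g : entire) : (forall n, f n = g n) -> f = g.
Proof. by move=> fg; apply/val_inj/funext. Qed.

Lemma entire_bound (a : nat -> K) : is_entire v a ->
  forall r e : R, 0 < r -> 0 < e ->
    exists N, forall n, (N <= n)%N -> v (a n) * r ^+ n < e.
Proof.
move=> ha r e r0 e0; have /cvgrPdist_lt/(_ e e0)[N _ hN] := ha r r0.
exists N => n /hN /=; rewrite sub0r normrN ger0_norm//.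
by rewrite mulr_ge0 ?absval_ge0// exprn_ge0// ltW.
Qed.

Lemma is_entire_bound (a : nat -> K) :
  (forall r e : R, 0 < r -> 0 < e ->
    exists N, forall n, (N <= n)%N -> v (a n) * r ^+ n <= e) -> is_entire v a.
Proof.
move=> ha r r0; apply/cvgrPdist_le => e e0; have [N hN] := ha r e r0 e0.
exists N => // n /hN /=; rewrite sub0r normrN ger0_norm//.
by rewrite mulr_ge0 ?absval_ge0// exprn_ge0// ltW.
Qed.

Lemma entire_bounded (a : nat -> K) (r : R) : is_entire v a -> 0 < r ->
  exists2 M : R, 0 < M & forall n, v (a n) * r ^+ n <= M.
Proof.
move=> ha r0; have [N hN] := entire_bound ha r0 ltr01.
have t0 n : 0 <= v (a n) * r ^+ n.
  by rewrite mulr_ge0 ?absval_ge0// exprn_ge0// ltW.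
exists (1 + \sum_(i < N) v (a i) * r ^+ i) => [|n].
  by rewrite ltr_wpDr// sumr_ge0.
have [/hN/ltW le1|nN] := leqP N n.
  by rewrite (le_trans le1)// lerDl sumr_ge0.
rewrite (bigD1 (Ordinal nN))//= addrCA lerDl.
by rewrite addr_ge0// sumr_ge0.
Qed.

Lemma is_entireD (a b : nat -> K) : is_entire v a -> is_entire v b ->
  is_entire v (fun n => a n + b n).
Proof.
move=> ha hb; apply: is_entire_bound => r e r0 e0.
have [N hN] := entire_bound ha r0 e0; have [M hM] := entire_bound hb r0 e0.
exists (maxn N M) => n; rewrite geq_max => /andP[Nn Mn].
have rn0 : 0 <= r ^+ n by rewrite exprn_ge0// ltW.
rewrite (le_trans (ler_wpM2r rn0 (absvalD v _ _)))//.
by rewrite maxr_pMl// ge_max !ltW// ?hN ?hM.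
Qed.

Lemma is_entireN (a : nat -> K) : is_entire v a ->
  is_entire v (fun n => - a n).
Proof. by move=> ha r r0; under eq_fun do rewrite absvalN; exact: ha. Qed.

Lemma is_entire_poly (p : {poly K}) : is_entire v (fun n => p`_n).
Proof.
apply: is_entire_bound => r e r0 e0; exists (size p) => n pn.
by rewrite nth_default// absval0 mul0r ltW.
Qed.

Definition cauchy_prod (a b : nat -> K) (n : nat) : K :=
  \sum_(i < n.+1) a i * b (n - i)%N.

Lemma is_entireM (a b : nat -> K) : is_entire v a -> is_entire v b ->
  is_entire v (cauchy_prod a b).
Proof.
move=> ha hb; apply: is_entire_bound => r e r0 e0.
have [A A0 hA] := entire_bounded ha r0.
have [B B0 hB] := entire_bounded hb r0.
have [N hN] := entire_bound ha r0 (divr_gt0 e0 B0).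
have [M hM] := entire_bound hb r0 (divr_gt0 e0 A0).
exists (N + M)%N => n NMn.
have rn0 k : 0 < r ^+ k by rewrite exprn_gt0.
rewrite -ler_pdivlMr//; apply: (absval_sum_le (F := fun i => a i * b (n - i)%N)).
  by rewrite divr_ge0 ?ltW.
move=> i; rewrite ltnS => i_n; rewrite ler_pdivlMr//.
rewrite absvalM -{2}(subnKC i_n) exprD mulrACA.
have t0 (c : nat -> K) k : 0 <= v (c k) * r ^+ k.
  by rewrite mulr_ge0 ?absval_ge0// ltW.
have [Ni|iN] := leqP N i.
  rewrite -(divfK (lt0r_neq0 B0) e) ler_pM// ltW//; exact: hN.
have Mi : (M <= n - i)%N.
  by rewrite leq_subRL// (leq_trans _ NMn)// leq_add2r ltnW.
rewrite mulrC -(divfK (lt0r_neq0 A0) e) ler_pM// ltW//; exact: hM.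
Qed.

Let zero := mk_entire (is_entire_poly 0).
Let one := mk_entire (is_entire_poly 1).
Let add (f g : entire) := mk_entire (is_entireD (entireP f) (entireP g)).
Let opp (f : entire) := mk_entire (is_entireN (entireP f)).
Let mul (f g : entire) := mk_entire (is_entireM (entireP f) (entireP g)).

Let addA : associative add.
Proof. by move=> f g h; apply: eq_entire => n /=; rewrite addrA. Qed.
Let addC : commutative add.
Proof. by move=> f g; apply: eq_entire => n /=; rewrite addrC. Qed.
Let add0 : left_id zero add.
Proof. by move=> f; apply: eq_entire => n /=; rewrite coef0 add0r. Qed.
Let addN : left_inverse zero opp add.
Proof. by move=> f; apply: eq_entire => n /=; rewrite addNr coef0. Qed.

HB.instance Definition _ := GRing.isZmodule.Build entire addA addC add0 addN.

(* Ring identities are transported from [{poly K}] by truncation. *)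
Let trunc (n : nat) (f : nat -> K) : {poly K} := \poly_(i < n.+1) f i.

Let coef_trunc n f k : (k <= n)%N -> (trunc n f)`_k = f k.
Proof. by move=> kn; rewrite coef_poly ltnS kn. Qed.

Let cauchy_prod_trunc n (f g : nat -> K) (p q : {poly K}) k : (k <= n)%N ->
  (forall i, (i <= n)%N -> p`_i = f i) -> (forall i, (i <= n)%N -> q`_i = g i) ->
  (p * q)`_k = cauchy_prod f g k.
Proof.
move=> kn hp hq; rewrite coefM; apply: eq_bigr => i _.
by rewrite hp ?hq// (leq_trans _ kn)// ?leq_subr// -ltnS.
Qed.

Let mulA : associative mul.
Proof.
move=> f g h; apply: eq_entire => n /=.
pose T := trunc n.
rewrite -(@cauchy_prod_trunc n f _ (T f) (T g * T h) n)//; last first.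
- by move=> i ni; apply: (@cauchy_prod_trunc n) => // j; apply: coef_trunc.
- by move=> j; apply: coef_trunc.
rewrite -(@cauchy_prod_trunc n _ h (T f * T g) (T h) n) ?mulrA//.
- by move=> i ni; apply: (@cauchy_prod_trunc n) => // j; apply: coef_trunc.
- by move=> j; apply: coef_trunc.
Qed.

Let mulC : commutative mul.
Proof.
move=> f g; apply: eq_entire => n /=; have T := @coef_trunc n.
rewrite -(@cauchy_prod_trunc n f g (trunc n f) (trunc n g) n)//; try exact: T.
by rewrite mulrC; apply: (@cauchy_prod_trunc n) => //; apply: T.
Qed.

Let mul1 : left_id one mul.
Proof.
move=> f; apply: eq_entire => n /=; have T := @coef_trunc n.
by rewrite -(@cauchy_prod_trunc n _ f 1 (trunc n f) n)// ?mul1r ?T//; apply: T.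
Qed.

Let mulD : left_distributive mul +%R.
Proof.
move=> f g h; apply: eq_entire => n /=; rewrite /cauchy_prod -big_split /=.
by apply: eq_bigr => i _; rewrite mulrDl.
Qed.

Let one_neq0 : one != 0.
Proof.
apply/eqP => /(congr1 (fun f : entire => f 0)) /=.
by rewrite coef1 coef0 => /eqP; rewrite oner_eq0.
Qed.

HB.instance Definition _ :=
  GRing.Zmodule_isComNzRing.Build entire mulA mulC mul1 mulD one_neq0.

Let unit : {pred entire} := fun f => `[< exists g : entire, g * f = 1 >].
Let inv (f : entire) : entire :=
  if pselect (exists g : entire, g * f = 1) is left h then projT1 (cid h) else f.

Let mulV : {in unit, left_inverse 1 inv *%R}.
Proof.
by move=> f /asboolP hf; rewrite /inv; case: pselect => // h; case: cid.
Qed.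
Let unitP (f g : entire) : g * f = 1 -> unit f.
Proof. by move=> gf; apply/asboolP; exists g. Qed.
Let inv_out : {in [predC unit], inv =1 id}.
Proof.
by move=> f /negP hf; rewrite /inv; case: pselect => // h; case: hf; apply/asboolP.
Qed.

HB.instance Definition _ :=
  GRing.ComNzRing_hasMulInverse.Build entire mulV unitP inv_out.

Lemma coef_entireD (f g : entire) n : (f + g) n = f n + g n.
Proof. by []. Qed.

Lemma coef_entireN (f : entire) n : (- f) n = - f n.
Proof. by []. Qed.

Lemma coef_entireM (f g : entire) n :
  (f * g) n = \sum_(i < n.+1) f i * g (n - i)%N.
Proof. by []. Qed.

Lemma coef_entire0 n : (0 : entire) n = 0.
Proof. exact: coef0. Qed.

Lemma coef_entire1 n : (1 : entire) n = (n == 0)%:R.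
Proof. exact: coef1. Qed.

Lemma entire_eq0 (f : entire) : (forall n, f n = 0) -> f = 0.
Proof. by move=> f0; apply: eq_entire => n; rewrite f0 /= coef0. Qed.

Let entire_order (f : entire) : f != 0 ->
  exists2 m, f m != 0 & forall i, (i < m)%N -> f i = 0.
Proof.
move=> f0; have ex : exists n, f n != 0.
  apply: contrapT => /forallNP h; case/eqP: f0; apply: entire_eq0 => n.
  by apply/eqP/negPn/negP/h.
case: (ex_minnP ex) => m fm min; exists m => // i im.
by apply/eqP; apply: contraTT im => /min; rewrite -leqNgt.
Qed.

Let entire_idomain : GRing.integral_domain_axiom entire.
Proof.
move=> f g fg0; apply: contraT; rewrite negb_or.
case/andP => /entire_order[m fm hf] /entire_order[n gn hg].
have /eqP : (f * g) (m + n)%N = 0 by rewrite fg0 /= coef0.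
have mlt : (m < (m + n).+1)%N by rewrite ltnS leq_addr.
rewrite /= /cauchy_prod (bigD1 (Ordinal mlt))//= addKn big1 ?addr0.
  by rewrite mulf_eq0 (negPf fm) (negPf gn).
move=> i im; have [/hf->|mi] := ltnP i m; first by rewrite mul0r.
rewrite [X in _ * X]hg ?mulr0//.
have mi' : (m < i)%N by rewrite ltn_neqAle mi andbT eq_sym; exact: im.
by rewrite ltn_subLR ?ltn_add2r// -ltnS.
Qed.

HB.instance Definition _ :=
  GRing.ComUnitRing_isIntegral.Build entire entire_idomain.

Definition entireC (c : K) : entire := mk_entire (is_entire_poly c%:P).

Lemma coef_entireC (c : K) n : entireC c n = if n == 0 then c else 0.
Proof. exact: coefC. Qed.

Let entireC_zmod : zmod_morphism entireC.
Proof. by move=> c d; apply: eq_entire => n; rewrite /= polyCB coefB. Qed.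
Let entireC_monoid : monoid_morphism entireC.
Proof.
split=> [|c d]; apply: eq_entire => n //=; rewrite polyCM.
exact: (@cauchy_prod_trunc n).
Qed.

HB.instance Definition _ :=
  GRing.isZmodMorphism.Build K entire entireC entireC_zmod.
HB.instance Definition _ :=
  GRing.isMonoidMorphism.Build K entire entireC entireC_monoid.

Definition meromorphic := {fraction entire}.

Definition meroC : K -> meromorphic := @tofrac entire \o entireC.

HB.instance Definition _ := GRing.RMorphism.on meroC.

End Entire.

Section Uniqueness.
Variables (R : realType) (K : fieldType) (v : nonarch_absval R K).

Definition UPM (P : {poly K}) : Prop :=
  (1 < size P)%N /\
  forall f g : meromorphic v,
    ~ (exists c, f = meroC v c) -> ~ (exists c, g = meroC v c) ->
    (map_poly (meroC v) P).[f] = (map_poly (meroC v) P).[g] -> f = g.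

Definition UPE (P : {poly K}) : Prop :=
  (1 < size P)%N /\
  forall f g : entire v,
    ~ (exists c, f = entireC v c) -> ~ (exists c, g = entireC v c) ->
    (map_poly (entireC v) P).[f] = (map_poly (entireC v) P).[g] -> f = g.

End Uniqueness.

(* A column is a class of critical points of [P] having the same critical
   value; it is handled as a finite set [C], and the lists attached to it
   contain multiplicities of its points as zeros of [P^`()]. *)
Section Columns.
Variables (K : fieldType) (P : {poly K}).
Local Open Scope fset_scope.

(* [fset_set] sends an infinite set to [fset0]: over an infinite field,
   [crit = fset0] when [P] is constant. *)
Definition crit : {fset K} := fset_set [set d | root P^`() d].

Definition critmult (d : K) : nat := mup d P^`().

Definition column (d : K) : {fset K} := [fset d' in crit | P.[d'] == P.[d]].

Definition columns : {fset {fset K}} := [fset column d | d in crit].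

Section Column.
Variable C : {fset K}.

Definition multlist : seq nat := [seq critmult d | d <- C].

Definition multA : seq nat := [seq q <- multlist | count_mem q multlist == 1%N].

Definition multA_H1 : seq nat :=
  [seq q <- multA | all (fun q' => (q' \notin multA) ==> (q' < q)%N) multlist].

Definition multA_H2 : seq nat :=
  [seq q <- multA_H1 | (\max_(a <- multA_H1) a + 1 < 2 * (q + 1))%N].

Definition colB_H2 : {fset K} := [fset d in C | critmult d \in multA_H2].

End Column.

Definition tnum : nat := #|` [fset C in columns | colB_H2 C != fset0]|.

Definition tnum' : nat := #|` \bigcup_(C <- columns) colB_H2 C|.

End Columns.

(* Main.v *)
Require Import Defs.
From mathcomp Require Import all_boot all_order all_algebra finmap.
From mathcomp Require Import all_classical all_reals all_analysis.
From mathcomp Require Import fraction generic_quotient ring lra zify.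

Set Implicit Arguments.
Unset Strict Implicit.
Unset Printing Implicit Defensive.

Import Order.TTheory GRing.Theory Num.Theory.
Import numFieldNormedType.Exports.
Local Open Scope ring_scope.

(** Let [f] and [g] be distinct nonconstant functions with [P(f) = P(g)], let
    [B] be the set of the critical points counted by [tnum'] and [k] its
    cardinality. Everything follows from the study of one function,

      W = (f' g' (f - g))^2 / prod_{d in B} (f - d)(g - d).

    Let mu_x denote the multiplicity with which [P] takes its value at [x].
    The selection of [B] ensures that if [a] is in [B], [b] is another point
    and P(b) = P(a), then mu_b <> mu_a and mu_b < 2 mu_a
    ([good_points_separated]).

    [W] has no pole ([test_fun_regular]). Indeed, at a point where [f] takes
    the value [a] with multiplicity [m] and [g] the value [b] with
    multiplicity [n], the identity P(f) = P(g) gives P(a) = P(b) and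
    m mu_a = n mu_b. If a = b, then m = n and f - g vanishes to the order [m]
    at least. If [a] is in [B] and a <> b, then n >= 2: otherwise
    mu_b = m mu_a < 2 mu_a, so that m = 1 and mu_b = mu_a. In all cases the
    zeros of f', g' and f - g outweigh those of the denominator. At a common
    pole of order [p], the order of [W] is at least (2k - 6)p - 4, which is
    nonnegative if k >= 5; entire functions have no pole at all.

    On the other hand [W] is small on large discs ([test_fun_bound]). The
    norm |h|_r = max_n |h_n| r^n is multiplicative and |h'|_r <= |h|_r / r.
    As [f] can be close to one point [d] of [B] at most, and f' = (f - d)' is
    then as small as f - d, and as |f|_r = |g|_r when one of them is large,
    |W|_r <= C / r^4 as soon as k >= 3.

    Now a function without poles obeys the maximum principle
    |W|_1 <= |W|_r ([gauss_absval_regular]), so that W = 0. This is absurd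
    because f', g' and f - g are nonzero. The maximum principle rests on the
    fact that an entire function whose norm on a disc is not that of its
    constant term has a zero in this disc ([entire_zero]): the zeros of a
    denominator can be simplified one by one until its norm is constant on
    the disc. The order at the point [a] is the valuation of the fraction
    field of the ring of entire functions at its prime element z - a. *)

Local Notation "x %:F" := (@FracField.tofrac _ x).

(** * Fractions and derivations *)

Section Fractions.
Variable A : idomainType.
Implicit Types (a b u w : A) (x y : {fraction A}).

Definition fnum x : A := (frac (repr x)).1.
Definition fden x : A := (frac (repr x)).2.

Lemma fden_neq0 x : fden x != 0.
Proof. exact: denom_ratioP. Qed.

Lemma fden_fracE x : x = (fnum x)%:F / (fden x)%:F.
Proof.
have dF : (fden x)%:F != 0 by rewrite tofrac_eq0 fden_neq0.
apply: (mulIf dF); rewrite divfK//.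
suff h (r : {ratio A}) : \pi_{fraction A}%qT r * (frac r).2%:F = (frac r).1%:F.
  by rewrite -h reprK.
case: r => [[a b] /= b0]; unlock FracField.tofrac; rewrite -[LHS]FracField.pi_mul.
apply/eqmodP; rewrite /= FracField.equivfE /FracField.mulf /=.
by rewrite !numden_Ratio ?oner_eq0 ?mulr1// mulrC.
Qed.

Lemma frac_eq a b u w : b != 0 -> w != 0 ->
  a%:F / b%:F = u%:F / w%:F -> a * w = u * b.
Proof.
move=> b0 w0 /eqP; rewrite eqr_div ?tofrac_eq0// -!tofracM tofrac_eq.
by move/eqP.
Qed.

Lemma frac_ind (T : {fraction A} -> Prop) :
  (forall u w, w != 0 -> T (u%:F / w%:F)) -> forall x, T x.
Proof. by move=> h x; rewrite (fden_fracE x); apply/h/fden_neq0. Qed.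

End Fractions.

Section Derivations.

Definition derivation (A : idomainType) (D : A -> A) :=
  (forall a b, D (a + b) = D a + D b) /\
  (forall a b, D (a * b) = D a * b + a * D b).

Section DerivationTheory.
Variables (A : idomainType) (D : A -> A) (derD : derivation D).

Lemma derD_add a b : D (a + b) = D a + D b. Proof. exact: derD.1. Qed.
Lemma derD_mul a b : D (a * b) = D a * b + a * D b. Proof. exact: derD.2. Qed.

Lemma derD0 : D 0 = 0.
Proof. by apply: (addrI (D 0)); rewrite addr0 -derD_add addr0. Qed.
Lemma derDN a : D (- a) = - D a.
Proof. by apply: (addrI (D a)); rewrite -derD_add !subrr derD0. Qed.
Lemma derDB a b : D (a - b) = D a - D b.
Proof. by rewrite derD_add derDN. Qed.
Lemma derD1 : D 1 = 0.
Proof.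
by apply: (addrI (D 1)); rewrite addr0 -{3}[1]mulr1 derD_mul mulr1 mul1r.
Qed.
Lemma derDX a n : D (a ^+ n) = a ^+ n.-1 * D a *+ n.
Proof.
elim: n => [|[|n] IH]; first by rewrite derD1.
  by rewrite expr1 mul1r.
rewrite exprS derD_mul IH /= mulrnAr mulrA -exprS mulrC [in RHS]mulrS.
by rewrite -mulrnAl.
Qed.
End DerivationTheory.

Variables (A : idomainType) (D : A -> A) (derD : derivation D).

(** The quotient rule applied to one representative; by [fderivE] any other one
    gives the same result. *)
Definition fderiv (x : {fraction A}) : {fraction A} :=
  (D (fnum x) * fden x - fnum x * D (fden x))%:F / (fden x ^+ 2)%:F.

Lemma fderivE u w : w != 0 ->
  fderiv (u%:F / w%:F) = (D u * w - u * D w)%:F / (w ^+ 2)%:F.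
Proof.
move=> w0; set x := _ / _; rewrite /fderiv.
have := fden_fracE x; have := fden_neq0 x.
move: (fnum x) (fden x) => a b b0 xE.
have E : a * w = u * b by apply: frac_eq => //; rewrite -xE.
have DE : D a * w + a * D w = D u * b + u * D b by rewrite -!derD.2 E.
apply/eqP; rewrite eqr_div ?tofrac_eq0 ?expf_neq0// -!tofracM tofrac_eq.
apply/eqP.
transitivity ((D a * w) * b * w - (a * w) * D b * w); first by ring.
have -> : D a * w = D u * b + u * D b - a * D w by rewrite -DE addrK.
transitivity (D u * b ^+ 2 * w + u * b * w * D b - (a * w) * b * D w
  - (a * w) * D b * w); first by ring.
by rewrite E; ring.
Qed.

Lemma fderiv_derivation : derivation fderiv.
Proof.
split=> x y.
  move: x y; apply: frac_ind => a b b0; apply: frac_ind => u w w0.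
  have F (z : A) : z != 0 -> z%:F != 0 :> {fraction A} by rewrite tofrac_eq0.
  rewrite addf_div ?F// -!tofracM -tofracD !fderivE ?mulf_neq0//.
  rewrite addf_div ?F ?expf_neq0// -!tofracM -tofracD.
  apply/eqP; rewrite eqr_div ?F ?mulf_neq0 ?expf_neq0 ?mulf_neq0//.
  by rewrite -!tofracM tofrac_eq !derD.1 !derD.2; apply/eqP; ring.
move: x y; apply: frac_ind => a b b0; apply: frac_ind => u w w0.
have F (z : A) : z != 0 -> z%:F != 0 :> {fraction A} by rewrite tofrac_eq0.
rewrite mulf_div -!tofracM !fderivE ?mulf_neq0//.
rewrite !mulf_div -!tofracM addf_div ?F ?mulf_neq0 ?expf_neq0//.
rewrite -!tofracM -tofracD.
apply/eqP; rewrite eqr_div ?F ?mulf_neq0 ?expf_neq0 ?mulf_neq0//.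
by rewrite -!tofracM tofrac_eq !derD.2; apply/eqP; ring.
Qed.

Lemma fderiv_tofrac a : fderiv a%:F = (D a)%:F.
Proof.
rewrite -[a%:F]divr1 -tofrac1 fderivE ?oner_eq0//.
by rewrite (derD1 derD) mulr0 mulr1 subr0 expr1n tofrac1 divr1.
Qed.

End Derivations.

Lemma derV (F : fieldType) (D : F -> F) (derD : derivation D) x : x != 0 ->
  D x^-1 = - D x / x ^+ 2.
Proof.
move=> x0; apply: (mulfI x0).
have /eqP : D (x * x^-1) = 0 by rewrite mulfV ?derD1.
rewrite derD.2 addrC addr_eq0 => /eqP ->.
by field.
Qed.

(** * Orders at a place *)

(** A discrete valuation; its value at [0] is meaningless, hence the conditions
    that the elements and their sum are nonzero. *)
Record place (F : fieldType) := Place {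
  ord :> F -> int;
  ordM : forall x y, x != 0 -> y != 0 -> ord (x * y) = ord x + ord y;
  ordD : forall (n : int) x y, x != 0 -> y != 0 -> x + y != 0 ->
    n <= ord x -> n <= ord y -> n <= ord (x + y) }.

Section PlaceTheory.
Variables (F : fieldType) (o : place F).
Implicit Types x y : F.

Lemma ord1 : o 1 = 0.
Proof.
have : o (1 * 1) = o 1 + o 1 by rewrite ordM ?oner_eq0.
by rewrite mulr1; lia.
Qed.

Lemma ordN x : o (- x) = o x.
Proof.
have [->|x0] := eqVneq x 0; first by rewrite oppr0.
have N1 : (-1 : F) != 0 by rewrite oppr_eq0 oner_eq0.
have : o (-1 * -1) = o (-1) + o (-1) by rewrite ordM.
by rewrite mulrNN mulr1 ord1 -[- x]mulN1r ordM//; lia.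
Qed.

Lemma ordV x : x != 0 -> o x^-1 = - o x.
Proof.
move=> x0; have : o (x * x^-1) = o x + o x^-1 by rewrite ordM ?invr_eq0.
by rewrite mulfV// ord1; lia.
Qed.

Lemma ord_div x y : x != 0 -> y != 0 -> o (x / y) = o x - o y.
Proof. by move=> x0 y0; rewrite ordM ?invr_eq0// ordV. Qed.

Lemma ordX x n : x != 0 -> o (x ^+ n) = o x * n%:Z.
Proof.
move=> x0; elim: n => [|n IH]; first by rewrite ord1 mulr0.
by rewrite exprS ordM ?expf_neq0// IH; lia.
Qed.

Lemma ordXz x (n : int) : x != 0 -> o (x ^ n) = o x * n.
Proof.
move=> x0; case: n => n; first exact: ordX.
by rewrite NegzE -exprz_inv -exprnP ordX ?invr_eq0// ordV//; lia.
Qed.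

Lemma ord_prod (I : eqType) (s : seq I) (f : I -> F) :
  (forall i, f i != 0) -> o (\prod_(i <- s) f i) = \sum_(i <- s) o (f i).
Proof.
move=> f0; elim: s => [|i s IH]; first by rewrite !big_nil ord1.
rewrite !big_cons ordM ?IH//.
by elim: s {IH} => [|j s IH]; rewrite ?big_nil ?oner_eq0// big_cons mulf_neq0.
Qed.

Lemma ordB_ge (n : int) x y : x != 0 -> y != 0 -> x - y != 0 ->
  n <= o x -> n <= o y -> n <= o (x - y).
Proof.
by move=> x0 y0 xy nx ny; apply: ordD; rewrite ?oppr_eq0// ordN.
Qed.

(** If the order of the sum were larger than that of [x], then subtracting [y]
    would make that of [x] larger than itself. *)
Lemma ordD_lt x y : x != 0 -> y != 0 -> o x < o y ->
  x + y != 0 /\ o (x + y) = o x.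
Proof.
move=> x0 y0 xy; have xy0 : x + y != 0.
  by apply/eqP => /eqP; rewrite addr_eq0 => /eqP xE; move: xy; rewrite xE ordN ltxx.
split => //; apply/le_anti/andP; split; last by apply: ordD => //; lia.
rewrite leNgt; apply/negP => lt.
suff : o x + 1 <= o (x + y - y) by rewrite addrK; lia.
by apply: ordB_ge; rewrite ?addrK//; lia.
Qed.

End PlaceTheory.

Lemma derXz (F : fieldType) (E : F -> F) (derE : derivation E) (x : F) (n : int) :
  x != 0 -> E (x ^ n) = n%:~R * x ^ (n - 1) * E x.
Proof.
move=> x0.
have h (k : nat) : E (x ^+ k) = k%:R * x ^ (k%:Z - 1) * E x.
  rewrite derDX//; case: k => [|k]; first by rewrite mulr0n !mul0r.
  have -> : k.+1%:Z - 1 = k by lia.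
  by rewrite -mulr_natl mulrA.
case: n => k; first exact: h.
rewrite NegzE -exprz_inv -exprnP exprVn derV ?expf_neq0// h.
have -> : (- k.+1%:Z) - 1 = (k.+1%:Z - 1) - (k.+1%:Z + k.+1%:Z) by lia.
have e : x ^ (k.+1%:Z + k.+1%:Z) = x ^+ k.+1 ^+ 2 by rewrite expfzDr.
rewrite [in RHS]expfzDr// -[x ^ (- _)]invr_expz e.
by rewrite mulrNz pmulrn !mulNr !mulrA; congr (- _); rewrite mulrAC.
Qed.

(** The derivative of [t ^ m * e] is [m * t ^ (m - 1) * e + t ^ m * E e], and its
    first term has the smaller order as [m] is invertible. *)
Lemma place_deriv_parameter (F : fieldType) (o : place F) (E : F -> F)
    (derE : derivation E) (t e : F) (m : int) :
  t != 0 -> o t = 1 -> E t = 1 -> e != 0 -> o e = 0 ->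
  (E e != 0 -> 0 <= o (E e)) -> m%:~R != 0 :> F -> o m%:~R = 0 ->
  E (t ^ m * e) != 0 /\ o (E (t ^ m * e)) = m - 1.
Proof.
move=> t0 ot Et e0 oe oEe m0 om; have tm0 n : t ^ n != 0 by exact: expfz_neq0.
rewrite derE.2 derXz// Et mulr1; set a := _ * e; set b := _ * E e.
have a0 : a != 0 by rewrite /a mulf_neq0// mulf_neq0.
have oa : o a = m - 1.
  by rewrite /a ordM ?mulf_neq0// ordM// om oe ordXz// ot; lia.
have [Ee0|Ee0] := eqVneq (E e) 0; first by rewrite /b Ee0 mulr0 addr0.
have b0 : b != 0 by rewrite /b mulf_neq0.
have ob : m <= o b.
  by rewrite /b ordM// ordXz// ot; have := oEe Ee0; lia.
by have [] := @ordD_lt _ o a b a0 b0; rewrite oa; [lia|].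
Qed.

Section PrimePlace.
Variables (A : idomainType) (p : A).

Definition divides (a b : A) := exists c, b = a * c.

Definition prime_elt :=
  [/\ p != 0, ~ divides p 1 &
    forall a b, divides p (a * b) -> divides p a \/ divides p b].

(** Krull's intersection property at [p], stated as such because rings of entire
    functions are not noetherian. *)
Definition finite_order :=
  forall a, a != 0 -> exists n b, a = p ^+ n * b /\ ~ divides p b.

Hypotheses (p_prime : prime_elt) (p_fin : finite_order).

Let p0 : p != 0. Proof. by case: p_prime. Qed.
Let pF0 : p%:F != 0. Proof. by rewrite tofrac_eq0. Qed.

Lemma ndivides_neq0 a : ~ divides p a -> a != 0.
Proof. by move=> h; apply/eqP => a0; apply: h; exists 0; rewrite mulr0. Qed.

Lemma ndividesM a b : ~ divides p a -> ~ divides p b -> ~ divides p (a * b).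
Proof. by move=> ha hb; case: p_prime => _ _ h /h[]. Qed.

Definition has_ord (x : {fraction A}) (n : int) := exists u w : A,
  [/\ ~ divides p u, ~ divides p w & x = p%:F ^ n * (u%:F / w%:F)].

Lemma has_ord_uniq x n m : has_ord x n -> has_ord x m -> n = m.
Proof.
wlog nm : n m / n <= m.
  move=> h xn xm; have [nm|/ltW mn] := leP n m; first exact: h.
  exact/esym/h.
move=> [u [w [pu pw ->]]] [a [b [pa pb e]]].
have w0 := ndivides_neq0 pw; have b0 := ndivides_neq0 pb.
have [k mE] : exists k : nat, m = n + k by exists `|m - n|%N; lia.
have : u%:F / w%:F = (p ^+ k * a)%:F / b%:F.
  apply: (mulfI (expfz_neq0 n pF0)); rewrite e mE expfzDr//.
  by rewrite tofracM tofracXn !mulrA.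
move/(frac_eq w0 b0) => E.
case: k mE E => [|k] mE E; first by rewrite mE addr0.
case: (ndividesM pu pb); rewrite E; exists (p ^+ k * a * w).
by rewrite exprS !mulrA.
Qed.

Lemma has_ord_ex x : x != 0 -> exists n, has_ord x n.
Proof.
move: x; apply: frac_ind => u w w0 uw.
have u0 : u != 0 by apply: contraNneq uw => ->; rewrite tofrac0 mul0r.
have [n [a [-> pa]]] := p_fin u0; have [m [b [-> pb]]] := p_fin w0.
exists (n%:Z - m%:Z), a, b; split => //.
by rewrite !tofracM !tofracXn expfzDr// -invr_expz invfM mulrACA.
Qed.

Definition prime_ord (x : {fraction A}) : int :=
  if pselect (exists n, has_ord x n) is left h then projT1 (cid h) else 0.

Lemma prime_ordP x n : has_ord x n -> prime_ord x = n.
Proof.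
move=> h; rewrite /prime_ord; case: pselect => [h'|]; last by case; exists n.
by case: cid => m /= /has_ord_uniq; apply.
Qed.

Lemma has_prime_ord x : x != 0 -> has_ord x (prime_ord x).
Proof. by move=> /has_ord_ex[n h]; rewrite (prime_ordP h). Qed.

Lemma prime_ordM x y : x != 0 -> y != 0 ->
  prime_ord (x * y) = prime_ord x + prime_ord y.
Proof.
move=> /has_prime_ord[u [w [pu pw xE]]] /has_prime_ord[a [b [pa pb yE]]].
apply: prime_ordP; exists (u * a), (w * b); split; try exact: ndividesM.
by rewrite {1}xE {1}yE expfzDr// !tofracM invfM mulrACA (mulrACA u%:F).
Qed.

(** Elements of order at least [n] are those with a denominator prime to [p] once
    [p ^ n] is factored out, so that sums reduce to a common denominator. *)
Lemma prime_ord_ge x (n : int) : x != 0 -> n <= prime_ord x <->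
  exists u w, ~ divides p w /\ x = p%:F ^ n * (u%:F / w%:F).
Proof.
move=> x0; split=> [nx|[u [w [pw xE]]]].
  have [u [w [pu pw xE]]] := has_prime_ord x0.
  have [k kE] : exists k : nat, prime_ord x = n + k.
    by exists `|prime_ord x - n|%N; lia.
  exists (p ^+ k * u), w; split => //.
  by rewrite {1}xE kE expfzDr// tofracM tofracXn -!mulrA.
have u0 : u != 0.
  by apply: contraNneq x0 => u0; rewrite xE u0 tofrac0 mul0r mulr0.
have [k [a [uE pa]]] := p_fin u0.
suff /prime_ordP -> : has_ord x (n + k%:Z) by lia.
exists a, w; split => //.
by rewrite xE uE expfzDr// tofracM tofracXn -!mulrA.
Qed.

Lemma prime_ordD (n : int) x y : x != 0 -> y != 0 -> x + y != 0 ->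
  n <= prime_ord x -> n <= prime_ord y -> n <= prime_ord (x + y).
Proof.
move=> x0 y0 xy0 /(prime_ord_ge n x0)[u [w [pw xE]]].
move=> /(prime_ord_ge n y0)[a [b [pb yE]]]; apply/(prime_ord_ge n xy0).
exists (u * b + a * w), (w * b); split; first exact: ndividesM.
have w0 := ndivides_neq0 pw; have b0 := ndivides_neq0 pb.
rewrite xE yE -mulrDr addf_div ?tofrac_eq0//.
by rewrite -!tofracM -tofracD.
Qed.

Definition prime_place : place {fraction A} := Place prime_ordM prime_ordD.

Lemma prime_place_tofrac a : a != 0 -> 0 <= prime_place a%:F.
Proof.
move=> a0; apply/prime_ord_ge; first by rewrite tofrac_eq0.
exists a, 1; split; first by case: p_prime.
by rewrite expr0z mul1r tofrac1 divr1.
Qed.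

Lemma prime_place_unit a : ~ divides p a -> prime_place a%:F = 0.
Proof.
move=> pa; apply: prime_ordP; exists a, 1; split => //; first by case: p_prime.
by rewrite expr0z mul1r tofrac1 divr1.
Qed.

Lemma prime_place_gt0 a : a != 0 -> (1 <= prime_place a%:F) <-> divides p a.
Proof.
move=> a0; split=> [h|[c cE]].
  by apply: contrapT => /prime_place_unit oa; rewrite oa in h.
apply/prime_ord_ge; first by rewrite tofrac_eq0.
exists c, 1; split; first by case: p_prime.
by rewrite expr1z tofrac1 divr1 -tofracM cE.
Qed.

Variables (D : A -> A) (derD : derivation D).
Hypothesis Dp : D p = 1.
Hypothesis char0 : forall n : nat, ~ divides p n.+1%:R.

Lemma prime_place_deriv_ge0 x : x != 0 -> fderiv D x != 0 ->
  0 <= prime_place x -> 0 <= prime_place (fderiv D x).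
Proof.
move=> x0 Dx0 /(prime_ord_ge 0 x0)[u [w [pw]]]; rewrite expr0z mul1r => xE.
apply/(prime_ord_ge 0 Dx0); rewrite xE fderivE ?(ndivides_neq0 pw)//.
by exists (D u * w - u * D w), (w ^+ 2); split; rewrite ?expr0z ?mul1r//; exact: ndividesM.
Qed.

(** In characteristic zero, deriving lowers a nonzero order by one, for poles as
    well as for zeros. *)
Lemma prime_place_deriv x : x != 0 -> prime_place x != 0 ->
  fderiv D x != 0 /\ prime_place (fderiv D x) = prime_place x - 1.
Proof.
move=> x0 ox; have [u [w [pu pw xE]]] := has_prime_ord x0.
have derF := fderiv_derivation derD.
set m := prime_ord x in xE; set e := _ / _ in xE.
have e0 : e != 0.
  by rewrite mulf_neq0 ?invr_eq0 ?tofrac_eq0 ?ndivides_neq0.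
have oe : prime_place e = 0.
  by apply: prime_ordP; exists u, w; rewrite expr0z mul1r; split.
have op : prime_place p%:F = 1.
  apply: prime_ordP; exists 1, 1; rewrite expr1z tofrac1 divr1 mulr1.
  by split => //; case: p_prime.
have natF (k : nat) : k.+1%:R = (k.+1%:R : A)%:F.
  by rewrite rmorph_nat.
have nat0 (k : nat) : k.+1%:R != 0 :> {fraction A}.
  by rewrite natF tofrac_eq0 ndivides_neq0.
have ordnat (k : nat) : prime_place k.+1%:R = 0.
  by rewrite natF prime_place_unit.
have [m0 om] : m%:~R != 0 :> {fraction A} /\ prime_place m%:~R = 0.
  have : m != 0 by [].
  case: (m) => k; first by case: k => // k _; rewrite -pmulrn nat0 ordnat.
  by move=> _; rewrite NegzE mulrNz oppr_eq0 ordN -pmulrn nat0 ordnat.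
rewrite {1 2}xE; apply: place_deriv_parameter => //.
  by rewrite fderiv_tofrac// Dp tofrac1.
by move=> De0; apply: prime_place_deriv_ge0; rewrite ?oe.
Qed.

End PrimePlace.

(** * Non-archimedean absolute values *)

Section AbsvalExtra.
Variables (R : realType) (F : fieldType) (N : nonarch_absval R F).
Implicit Types x y : F.

Lemma absval_gt0 x : (0 < N x) = (x != 0).
Proof. by rewrite lt_def absval_eq0 absval_ge0 andbT. Qed.

Lemma absvalB x y : N (x - y) <= Num.max (N x) (N y).
Proof. by rewrite -(absvalN N y) absvalD. Qed.

Lemma absvalBC x y : N (x - y) = N (y - x).
Proof. by rewrite -absvalN opprB. Qed.

Lemma absvalX x n : N (x ^+ n) = N x ^+ n.
Proof. by elim: n => [|n IH]; rewrite ?absval1// !exprS absvalM IH. Qed.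

Lemma absvalV x : N x^-1 = (N x)^-1.
Proof.
have [->|x0] := eqVneq x 0; first by rewrite invr0 absval0 invr0.
have Nx0 : N x != 0 by rewrite absval_eq0.
by apply: (mulfI Nx0); rewrite -absvalM !mulfV// absval1.
Qed.

Lemma absval_div x y : N (x / y) = N x / N y.
Proof. by rewrite absvalM absvalV. Qed.

Lemma absval_prod (I : Type) (s : seq I) (f : I -> F) :
  N (\prod_(i <- s) f i) = \prod_(i <- s) N (f i).
Proof. by apply: (big_morph N (absvalM N) (absval1 N)). Qed.

Lemma absval_nat n : N n%:R <= 1.
Proof.
elim: n => [|n IH]; first by rewrite absval0.
by rewrite -addn1 natrD (le_trans (absvalD _ _ _))// ge_max IH absval1 lexx.
Qed.

(** The isosceles triangle principle. *)
Lemma absval_addl x y : N y < N x -> N (x + y) = N x.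
Proof.
move=> yx; apply/le_anti/andP; split.
  by rewrite (le_trans (absvalD _ _ _))// ge_max lexx ltW.
have : N (x + y - y) <= Num.max (N (x + y)) (N y) by exact: absvalB.
by rewrite addrK le_max => /orP[//|]; rewrite leNgt yx.
Qed.

Lemma absval_sum_lt (I : Type) (s : seq I) (P : pred I) (f : I -> F) (M : R) :
  0 < M -> (forall i, P i -> N (f i) < M) -> N (\sum_(i <- s | P i) f i) < M.
Proof.
move=> M0 h; apply: (big_ind (fun x => N x < M)) => //; first by rewrite absval0.
by move=> x y xM yM; rewrite (le_lt_trans (absvalD _ _ _))// gt_max xM yM.
Qed.

End AbsvalExtra.

Section FractionAbsval.
Variables (R : realType) (A : idomainType) (N : A -> R).
Hypotheses (N_ge0 : forall a, 0 <= N a) (N_eq0 : forall a, (N a == 0) = (a == 0)).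
Hypotheses (N_M : forall a b, N (a * b) = N a * N b).
Hypotheses (N_D : forall a b, N (a + b) <= Num.max (N a) (N b)).

Definition fabs (x : {fraction A}) : R := N (fnum x) / N (fden x).

Lemma fabs_frac u w : w != 0 -> fabs (u%:F / w%:F) = N u / N w.
Proof.
move=> w0; set x := _ / _; rewrite /fabs.
have := fden_fracE x; have := fden_neq0 x.
move: (fnum x) (fden x) => a b b0 xE.
have E : a * w = u * b by apply: frac_eq => //; rewrite -xE.
by apply/eqP; rewrite eqr_div ?N_eq0// -!N_M E.
Qed.

Let fabs_ge0 x : 0 <= fabs x.
Proof. by rewrite divr_ge0. Qed.

Let fabs_eq0 x : (fabs x == 0) = (x == 0).
Proof.
move: x; apply: frac_ind => u w w0; rewrite fabs_frac//.
by rewrite !mulf_eq0 !invr_eq0 tofrac_eq0 tofrac_eq0 !N_eq0.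
Qed.

Let fabsM x y : fabs (x * y) = fabs x * fabs y.
Proof.
move: x y; apply: frac_ind => a b b0; apply: frac_ind => u w w0.
by rewrite mulf_div -!tofracM !fabs_frac ?mulf_neq0// !N_M mulf_div.
Qed.

Let fabsD x y : fabs (x + y) <= Num.max (fabs x) (fabs y).
Proof.
move: x y; apply: frac_ind => a b b0; apply: frac_ind => u w w0.
rewrite addf_div ?tofrac_eq0// -!tofracM -tofracD !fabs_frac ?mulf_neq0//.
have [Nb Nw] : 0 < N b /\ 0 < N w by rewrite !lt_def !N_ge0 !N_eq0 b0 w0.
rewrite N_M ler_pdivrMr ?mulr_gt0// maxr_pMl ?mulr_ge0//.
have -> : N a / N b * (N b * N w) = N (a * w) by rewrite N_M; field; lra.
have -> : N u / N w * (N b * N w) = N (u * b) by rewrite N_M; field; lra.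
exact: N_D.
Qed.

Definition fraction_absval : nonarch_absval R {fraction A} :=
  NonarchAbsval fabs_ge0 fabs_eq0 fabsM fabsD.

Lemma fraction_absvalE u w : w != 0 -> fraction_absval (u%:F / w%:F) = N u / N w.
Proof. exact: fabs_frac. Qed.

End FractionAbsval.

(** * Gauss norms of entire functions *)

Section Gauss.
Variables (R : realType) (K : fieldType) (v : nonarch_absval R K).
Variables (r : R) (r0 : 0 < r).
Implicit Types f g : entire v.

Definition term f n : R := v (f n) * r ^+ n.

(** The last index where the Gauss norm on the disc of radius [r] is reached. If
    [K] is complete and algebraically closed, it is the number of zeros in this
    disc: it measures how many zeros remain to be divided out. *)
Definition is_peak f k :=
  (forall n, term f n <= term f k) /\ (forall n, (k < n)%N -> term f n < term f k).

Lemma term_ge0 f n : 0 <= term f n.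
Proof. by rewrite mulr_ge0 ?absval_ge0// exprn_ge0// ltW. Qed.

Lemma term_gt0 f n : (0 < term f n) = (f n != 0).
Proof. by rewrite lt_def term_ge0 andbT mulf_eq0 expf_eq0 (gt_eqF r0) andbF orbF absval_eq0. Qed.

Lemma is_peak_uniq f k l : is_peak f k -> is_peak f l -> k = l.
Proof.
wlog kl : k l / (k <= l)%N.
  move=> h fk fl; case/orP: (leq_total k l) => kl; first exact: h.
  exact/esym/h.
move=> [_ hk] [hl _]; apply/eqP; rewrite eqn_leq kl leqNgt; apply/negP => /hk.
by rewrite ltNge hl.
Qed.

Lemma is_peak_neq0 f k : f != 0 -> is_peak f k -> f k != 0.
Proof.
move=> f0 [hk _]; apply: contraNneq f0 => fk0; apply/eqP/entire_eq0 => n.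
apply/eqP; rewrite -(absval_eq0 v) -[_ == 0]orbF.
have : term f n <= 0 by have := hk n; rewrite {2}/term fk0 absval0 mul0r.
rewrite /term pmulr_lle0 ?exprn_gt0// => h.
by rewrite orbF; apply/eqP/le_anti; rewrite h absval_ge0.
Qed.

Lemma is_peak_ex f : f != 0 -> exists k, is_peak f k.
Proof.
move=> f0; have [m fm] : exists m, f m != 0.
  apply: contrapT => /forallNP h; case/eqP: f0; apply: entire_eq0 => n.
  by apply/eqP/negPn/negP/h.
have tm : 0 < term f m by rewrite term_gt0.
have [L hL] := entire_bound (entireP f) r0 tm.
have mL : (m < L)%N by rewrite ltnNge; apply/negP => /hL; rewrite ltxx.
pose i0 := [arg max_(i > Ordinal mL) term f (val i)]%O.
have i0max n : term f n <= term f i0.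
  rewrite /i0; case: Order.TotalTheory.arg_maxP => // i _ hi.
  have [/hL fn|nL] := leqP L n; last exact: (hi (Ordinal nL)).
  exact: (le_trans (ltW fn) (hi (Ordinal mL) _)).
have ex : exists k, term f k == term f i0 by exists i0.
have bd k : term f k == term f i0 -> (k <= L)%N.
  move=> /eqP e; rewrite leqNgt; apply/negP => /ltnW/hL; rewrite ltNge.
  by rewrite -/(term f k) e i0max.
case: (ex_maxnP ex bd) => k /eqP ek hk; exists k; split=> n; first by rewrite ek.
move=> kn; rewrite lt_neqAle ek i0max andbT; apply: contraL kn => /hk.
by rewrite -leqNgt.
Qed.

Definition peak f : nat := xget 0%N [set k | is_peak f k]%classic.

Lemma peakP f : f != 0 -> is_peak f (peak f).
Proof. by move=> /is_peak_ex[k fk]; apply: xgetPex; exists k. Qed.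

Definition gauss f : R := term f (peak f).

Lemma gauss0 : gauss 0 = 0.
Proof. by rewrite /gauss /term coef_entire0 absval0 mul0r. Qed.

Lemma is_peakE f k : f != 0 -> is_peak f k -> peak f = k /\ gauss f = term f k.
Proof. by move=> /peakP fp fk; rewrite /gauss (is_peak_uniq fp fk). Qed.

Lemma term_le f n : term f n <= gauss f.
Proof.
have [->|/peakP[]//] := eqVneq f 0.
by rewrite gauss0 /term coef_entire0 absval0 mul0r.
Qed.

Lemma gauss_ge0 f : 0 <= gauss f.
Proof. exact: term_ge0. Qed.

Lemma gauss_eq0 f : (gauss f == 0) = (f == 0).
Proof.
have [->|f0] := eqVneq f 0; first by rewrite gauss0 eqxx.
by rewrite gt_eqF// term_gt0; apply: is_peak_neq0 => //; exact: peakP.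
Qed.

Lemma gauss_gt0 f : f != 0 -> 0 < gauss f.
Proof. by rewrite lt_def gauss_ge0 gauss_eq0 andbT. Qed.

Lemma gauss_le f M : (forall n, term f n <= M) -> gauss f <= M.
Proof. exact. Qed.

Lemma gaussD f g : gauss (f + g) <= Num.max (gauss f) (gauss g).
Proof.
apply: gauss_le => n; rewrite /term coef_entireD.
have rn : 0 <= r ^+ n by rewrite exprn_ge0// ltW.
rewrite (le_trans (ler_wpM2r rn (absvalD v _ _)))//.
by rewrite maxr_pMl// ge_max !le_max !term_le orbT.
Qed.

(** In the coefficient of index [peak f + peak g] of the product, one term
    strictly dominates all the others; beyond this index all terms are
    strictly smaller. *)
Lemma peakM f g : f != 0 -> g != 0 ->
  peak (f * g) = (peak f + peak g)%N /\ gauss (f * g) = gauss f * gauss g.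
Proof.
move=> f0 g0; have [fk fk'] := peakP f0; have [gl gl'] := peakP g0.
have Fgt := gauss_gt0 f0; have Ggt := gauss_gt0 g0.
rewrite -!/(gauss _) in fk fk' gl gl'.
set k := peak f in fk' *; set l := peak g in gl' *.
have rn n : 0 < r ^+ n by rewrite exprn_gt0.
have tE n (i : 'I_n.+1) :
    v (f i * g (n - i)%N) * r ^+ n = term f i * term g (n - i)%N.
  by rewrite absvalM mulrACA -exprD subnKC// -ltnS.
have T0 n : 0 < gauss f * gauss g / r ^+ n by apply: divr_gt0 => //; exact: mulr_gt0.
(* products of terms beyond one of the two peaks are strictly dominated *)
have lt n (i : 'I_n.+1) : (k < i)%N || (l < n - i)%N ->
    v (f i * g (n - i)%N) < gauss f * gauss g / r ^+ n.
  move=> /orP h; rewrite ltr_pdivlMr// tE; case: h => [/fk'|/gl'] h.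
    by rewrite (le_lt_trans (ler_wpM2l (term_ge0 _ _) (gl _)))// ltr_pM2r.
  by rewrite (le_lt_trans (ler_wpM2r (term_ge0 _ _) (fk _)))// ltr_pM2l.
have tkl : term (f * g) (k + l)%N = gauss f * gauss g.
  have ik : (k < (k + l).+1)%N by rewrite ltnS leq_addr.
  rewrite /term coef_entireM (bigD1 (Ordinal ik))//= addKn absval_addl.
    by have := tE _ (Ordinal ik); rewrite /= addKn.
  have -> : v (f k * g l) = gauss f * gauss g / r ^+ (k + l).
    by apply: (mulIf (lt0r_neq0 (rn (k + l)%N))); rewrite divfK ?lt0r_neq0//;
       have := tE _ (Ordinal ik); rewrite /= addKn.
  apply: absval_sum_lt => // i ik'; apply: lt.
  have : nat_of_ord i != k by [].
  by have := ltn_ord i; lia.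
suff /(is_peakE (mulf_neq0 f0 g0))[-> ->] : is_peak (f * g) (k + l) by [].
split=> n; last first.
  rewrite tkl /term coef_entireM -ltr_pdivlMr// => kln.
  by apply: absval_sum_lt => // i _; apply: lt; have := ltn_ord i; lia.
rewrite tkl /term coef_entireM -ler_pdivlMr//.
apply: (absval_sum_le (F := fun i => f i * g (n - i)%N)); first exact: ltW.
move=> i ni; rewrite ler_pdivlMr//; have := tE n (Ordinal ni) => /= ->.
by rewrite ler_pM ?term_ge0 ?term_le.
Qed.

Lemma gaussM f g : gauss (f * g) = gauss f * gauss g.
Proof.
have [->|f0] := eqVneq f 0; first by rewrite mul0r gauss0 mul0r.
have [->|g0] := eqVneq g 0; first by rewrite mulr0 gauss0 mulr0.
by case: (peakM f0 g0).
Qed.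

Lemma peakC c : c != 0 -> peak (entireC v c) = 0%N /\ gauss (entireC v c) = v c.
Proof.
move=> c0; have C0 : entireC v c != 0.
  apply/eqP => /(congr1 (fun f : entire v => f 0%N)) /eqP.
  by rewrite coef_entireC coef_entire0 (negPf c0).
have tC : v c = term (entireC v c) 0 by rewrite /term coef_entireC expr0 mulr1.
suff /(is_peakE C0)[-> ->] : is_peak (entireC v c) 0 by rewrite -tC.
split=> [[|n]|[|n]//]; rewrite -?tC // /term coef_entireC /= absval0 mul0r.
  exact: absval_ge0.
by rewrite absval_gt0.
Qed.

Definition gauss_absval : nonarch_absval R (meromorphic v) :=
  fraction_absval gauss_ge0 gauss_eq0 gaussM gaussD.

Lemma gauss_absvalE f g : g != 0 -> gauss_absval (f%:F / g%:F) = gauss f / gauss g.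
Proof. exact: fraction_absvalE. Qed.

Lemma gauss_absval_const c : gauss_absval (meroC v c) = v c.
Proof.
have [->|c0] := eqVneq c 0; first by rewrite rmorph0 !absval0.
rewrite -[meroC v c]divr1 -(rmorph1 (meroC v)) gauss_absvalE; last first.
  by rewrite rmorph1 oner_eq0.
by rewrite !(peakC _).2 ?oner_eq0// absval1 divr1.
Qed.

End Gauss.

(** * Evaluation of entire functions *)

Section Limits.
Variables (R : realType) (K : fieldType) (v : nonarch_absval R K).
Implicit Types (s u : nat -> K) (l : K).

(** Convergence for [v], in this form because [K] carries no topology. *)
Definition tends s l :=
  forall e : R, 0 < e -> exists N, forall n, (N <= n)%N -> v (s n - l) < e.

Lemma tends_uniq s l l' : tends s l -> tends s l' -> l = l'.
Proof.
move=> hl hl'; apply/eqP; rewrite -subr_eq0; apply: contraT.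
rewrite -(absval_gt0 v) => e0; have [N hN] := hl _ e0; have [M hM] := hl' _ e0.
have := hM _ (leq_maxr N M); have := hN _ (leq_maxl N M).
set n := maxn N M => h1 h2.
have : v ((s n - l') - (s n - l)) < v (l - l').
  by rewrite (le_lt_trans (absvalB _ _ _))// gt_max h1 h2.
by rewrite opprB addrC addrA subrK ltxx.
Qed.

Lemma tends_shift s l : tends s l -> tends (fun n => s n.+1) l.
Proof.
by move=> h e /h[N hN]; exists N => n Nn; apply: hN; exact: leqW.
Qed.

Lemma tends_affine s l a b : tends s l -> tends (fun n => a + b * s n) (a + b * l).
Proof.
move=> h e e0; have B0 : 0 < Num.max 1 (v b) by rewrite lt_max ltr01.
have [N hN] := h _ (divr_gt0 e0 B0); exists N => n /hN hn.
rewrite opprD addrACA subrr add0r -mulrBr absvalM.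
rewrite (@le_lt_trans _ _ (Num.max 1 (v b) * v (s n - l)))//.
  by rewrite ler_wpM2r ?absval_ge0// le_max lexx orbT.
by rewrite mulrC -ltr_pdivlMr.
Qed.

Lemma tends_le s l M : tends s l -> (forall n, v (s n) <= M) -> v l <= M.
Proof.
move=> h sM; rewrite leNgt; apply/negP => Ml.
have l0 : 0 < v l by rewrite (le_lt_trans _ Ml)// (le_trans _ (sM 0%N))// absval_ge0.
have [N /(_ _ (leqnn N)) hN] := h _ l0.
have : v (l + (s N - l)) = v l by exact: absval_addl.
by rewrite addrC subrK => e; have := sM N; rewrite e leNgt Ml.
Qed.

(** Partial sums differ by sums of small terms, which are small by the
    ultrametric inequality. *)
Lemma tends_series (K_complete : absval_complete v) u :
  tends u 0 -> exists l, tends (fun n => \sum_(j < n) u j) l.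
Proof.
move=> hu; pose S n := \sum_(j < n) u j.
have SD m k : S (m + k)%N = S m + \sum_(j < k) u (m + j)%N.
  by rewrite /S big_split_ord.
have [|l hl] := K_complete S.
  move=> e e0; have [N hN] := hu e e0; exists N => m n Nm Nn.
  have h a b : (N <= a)%N -> (a <= b)%N -> v (S b - S a) < e.
    move=> Na /subnKC <-; rewrite SD addrC addKr.
    apply: absval_sum_lt => // j _; have := hN (a + j)%N; rewrite subr0; apply.
    by rewrite (leq_trans Na)// leq_addr.
  by case/orP: (leq_total m n) => mn; [rewrite absvalBC|]; exact: h.
exists l => e e0; have /cvgrPdist_lt/(_ e e0)[N _ hN] := hl.
by exists N => n /hN /=; rewrite sub0r normrN ger0_norm ?absval_ge0.
Qed.

End Limits.

Section Evaluation.
Variables (R : realType) (K : fieldType) (v : nonarch_absval R K).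
Variable (K_complete : absval_complete v).
Implicit Types (f g : entire v) (a : K).

Lemma tail_ex f a n :
  exists l, tends v (fun N => \sum_(j < N) f (n + j)%N * a ^+ j) l.
Proof.
apply: (tends_series K_complete (u := fun j => f (n + j)%N * a ^+ j)) => e e0; pose r : R := Num.max 1 (v a).
have r1 : 1 <= r by rewrite le_max lexx.
have r0 : 0 < r by exact: lt_le_trans r1.
have [N hN] := entire_bound (entireP f) r0 e0; exists N => m Nm.
rewrite subr0 absvalM absvalX.
apply: le_lt_trans (hN (n + m)%N _); last by rewrite (leq_trans Nm)// leq_addl.
rewrite ler_wpM2l ?absval_ge0// exprD.
rewrite (@le_trans _ _ (r ^+ m))//; last by rewrite ler_peMl ?exprn_ege1// exprn_ge0// ltW.
by rewrite lerXn2r ?nnegrE ?absval_ge0 ?(ltW r0)// le_max lexx orbT.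
Qed.

(** The value at [a] of the series with coefficients [f n, f n.+1, ...]. It gives
    both the value of [f] (for [n = 0]) and, by Horner's scheme [tail_rec], the
    coefficients of the quotient of [f] by [z - a]. *)
Definition tail f a n : K := projT1 (cid (tail_ex f a n)).

Lemma tailP f a n :
  tends v (fun N => \sum_(j < N) f (n + j)%N * a ^+ j) (tail f a n).
Proof. by rewrite /tail; case: cid. Qed.

Lemma tail_rec f a n : tail f a n = f n + a * tail f a n.+1.
Proof.
have h := tends_affine (f n) a (tailP f a n.+1).
apply: tends_uniq (tends_shift (tailP f a n)) _.
move=> e /h[N hN]; exists N => m /hN.
rewrite big_ord_recl /= addn0 mulr1 big_distrr /=.
congr (v (_ + _ - _) < e); apply: eq_bigr => j _.
by rewrite /bump /= add1n addnS addSn exprS mulrCA.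
Qed.

Lemma tail_le f a n (r M : R) : 0 < r -> v a <= r ->
  (forall k, (n <= k)%N -> term r f k <= M) -> v (tail f a n) * r ^+ n <= M.
Proof.
move=> r0 ar h; rewrite -ler_pdivlMr ?exprn_gt0//.
apply: tends_le (tailP f a n) _ => N.
have M0 : 0 <= M by rewrite (le_trans _ (h _ (leqnn n)))// term_ge0.
apply: (absval_sum_le (F := fun j => f (n + j)%N * a ^+ j)).
  by rewrite divr_ge0// exprn_ge0// ltW.
move=> j _; rewrite ler_pdivlMr ?exprn_gt0// absvalM absvalX.
apply: le_trans (h (n + j)%N (leq_addr _ _)).
rewrite /term -mulrA ler_wpM2l ?absval_ge0// exprD mulrC.
by rewrite ler_wpM2l ?exprn_ge0 ?(ltW r0)// lerXn2r ?nnegrE ?absval_ge0 ?(ltW r0).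
Qed.

Lemma is_entire_tail f a : is_entire v (fun n => tail f a n.+1).
Proof.
apply: is_entire_bound => r e r0 e0; pose s := Num.max r (v a).
have rs : r <= s by rewrite le_max lexx.
have s0 : 0 < s by exact: lt_le_trans rs.
have [N hN] := entire_bound (entireP f) s0 (mulr_gt0 e0 s0); exists N => n Nn.
rewrite (@le_trans _ _ (v (tail f a n.+1) * s ^+ n))//.
  by rewrite ler_wpM2l ?absval_ge0// lerXn2r ?nnegrE ?(ltW r0) ?(ltW s0).
rewrite -(ler_pM2r s0) -mulrA -exprSr; apply: tail_le => //.
  by rewrite le_max lexx orbT.
by move=> k nk; rewrite ltW// hN// (leq_trans Nn)// ltnW.
Qed.

Definition entire_poly (p : {poly K}) : entire v := mk_entire (is_entire_poly v p).

Lemma entire_polyM (p q : {poly K}) :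
  entire_poly (p * q) = entire_poly p * entire_poly q.
Proof. by apply: eq_entire => n; rewrite coef_entireM /= coefM. Qed.

Definition entireXsubC a : entire v := entire_poly ('X - a%:P).

Definition evalf f a : K := tail f a 0.

Lemma evalf_lim f a : tends v (fun N => \sum_(j < N) f j * a ^+ j) (evalf f a).
Proof. exact: (tailP f a 0). Qed.

(** Euclidean division by [z - a]. *)
Lemma evalf_divides_ex f a : exists h, f = entireC v (evalf f a) + entireXsubC a * h.
Proof.
exists (mk_entire (is_entire_tail f a)); apply: eq_entire => n.
rewrite coef_entireD coef_entireC coef_entireM.
case: n => [|n].
  rewrite big_ord_recl big_ord0 /= coefB coefX coefC /= sub0r addr0 mulNr.
  by rewrite /evalf tail_rec addrK.
rewrite !big_ord_recl big1 ?addr0 => [|i _].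
  rewrite /= !coefB !coefX !coefC /= sub0r subr0 mul1r add0r mulNr subSS subn0.
  by rewrite subn0 [tail f a n.+1]tail_rec; ring.
have -> : entireXsubC a (lift ord0 (lift ord0 i)) = 0.
  by rewrite /entireXsubC /= coefB coefX coefC /= subr0.
by rewrite mul0r.
Qed.

End Evaluation.

Section EntirePrime.
Variables (R : realType) (K : fieldType) (v : nonarch_absval R K).
Variable (K_complete : absval_complete v).
Implicit Types (f g : entire v) (a : K).

(** [z - a] has one zero in the disc of radius [r] if [v a <= r], none
    otherwise. *)
Lemma gauss_entireXsubC (r : R) a : 0 < r ->
  peak r (entireXsubC v a) = (v a <= r)%R /\ gauss r (entireXsubC v a) = Num.max r (v a).
Proof.
move=> r0; have c0 : entireXsubC v a 0 = - a.
  by rewrite /entireXsubC /= coefB coefX coefC /= sub0r.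
have c1 : entireXsubC v a 1 = 1 by rewrite /entireXsubC /= coefB coefX coefC /= subr0.
have c2 n : entireXsubC v a n.+2 = 0.
  by rewrite /entireXsubC /= coefB coefX coefC /= subr0.
have p0 : entireXsubC v a != 0.
  apply/eqP => e; have := c1; rewrite e coef_entire0 => /esym/eqP.
  by rewrite oner_eq0.
have t0 : term r (entireXsubC v a) 0 = v a by rewrite /term c0 absvalN expr0 mulr1.
have t1 : term r (entireXsubC v a) 1 = r by rewrite /term c1 absval1 mul1r expr1.
have t2 n : term r (entireXsubC v a) n.+2 = 0 by rewrite /term c2 absval0 mul0r.
have [ar|ra] := leP (v a) r.
  suff /(is_peakE r0 p0)[-> ->] : is_peak r (entireXsubC v a) 1 by rewrite t1.
  split=> [] [|[|n]]//; rewrite ?t0 ?t1 ?t2 ?lexx ?(ltW r0)//.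
suff /(is_peakE r0 p0)[-> ->] : is_peak r (entireXsubC v a) 0 by rewrite t0.
by split=> [] [|[|n]]//; rewrite ?t0 ?t1 ?t2 ?lexx ?(ltW ra) ?absval_ge0//
  (lt_trans r0).
Qed.

Lemma entireXsubC_neq0 a : entireXsubC v a != 0.
Proof.
apply/eqP => /(congr1 (fun f : entire v => f 1%N)) /eqP.
by rewrite /entireXsubC /= coefB coefX coefC /= subr0 coef0 oner_eq0.
Qed.

(** In a disc containing [a] a multiple of [z - a] has a positive peak, a
    constant does not. *)
Lemma entireXsubC_ndivides_const a c : c != 0 -> ~ divides (entireXsubC v a) (entireC v c).
Proof.
move=> c0 [g cE]; pose r : R := Num.max 1 (v a).
have r0 : 0 < r by rewrite lt_max ltr01.
have g0 : g != 0.
  apply/eqP => g0; have := (peakC v r0 c0).2.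
  by rewrite cE g0 mulr0 gauss0 => /esym/eqP; rewrite absval_eq0 (negPf c0).
have := (peakC v r0 c0).1; rewrite cE (peakM r0 (entireXsubC_neq0 a) g0).1.
by rewrite (gauss_entireXsubC a r0).1 le_max lexx orbT.
Qed.

Lemma divides_evalf f a : divides (entireXsubC v a) f <-> evalf K_complete f a = 0.
Proof.
have [h fE] := evalf_divides_ex K_complete f a; split=> [[g gE]|e0]; last first.
  by exists h; rewrite fE e0 rmorph0 add0r.
apply/eqP; apply: contraT => /(@entireXsubC_ndivides_const a); case.
exists (g - h); rewrite mulrBr -gE {2}fE.
by rewrite addrK.
Qed.

Lemma entireXsubC_prime a : prime_elt (entireXsubC v a).
Proof.
split; first exact: entireXsubC_neq0.
  by rewrite -(rmorph1 (entireC v)); apply/entireXsubC_ndivides_const/oner_neq0.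
move=> f g [c fgE]; rewrite !divides_evalf.
have [h fE] := evalf_divides_ex K_complete f a.
have [k gE] := evalf_divides_ex K_complete g a.
move: (evalf _ f a) (evalf _ g a) fE gE => x y fE gE.
suff /eqP : x * y = 0 by rewrite mulf_eq0 => /orP[] /eqP; [left|right].
apply/eqP; apply: contraT => /(@entireXsubC_ndivides_const a); case.
exists (c - entireC v x * k - h * g).
rewrite rmorphM /= !mulrBr -fgE mulrA [_ * entireC v x]mulrC -mulrA.
have -> : entireXsubC v a * k = g - entireC v y by rewrite gE addrC addKr.
have -> : entireXsubC v a * (h * g) = (f - entireC v x) * g.
  by rewrite fE addrC addKr mulrA.
by ring.
Qed.

(** The peak in a disc containing [a] decreases at each division. *)
Lemma entireXsubC_finite_order a : finite_order (entireXsubC v a).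
Proof.
move=> f; pose r : R := Num.max 1 (v a).
have r0 : 0 < r by rewrite lt_max ltr01.
elim: {f}_.+1 {-2}f (ltnSn (peak r f)) => // n IH f fn f0.
have [[g fE]|nd] := pselect (divides (entireXsubC v a) f); last first.
  by exists 0%N, f; rewrite mul1r.
have g0 : g != 0 by apply: contraNneq f0 => g0; rewrite fE g0 mulr0.
have : (peak r g < n)%N.
  move: fn; rewrite fE (peakM r0 (entireXsubC_neq0 a) g0).1 (gauss_entireXsubC a r0).1.
  by rewrite le_max lexx orbT.
move=> /IH/(_ g0)[m [h [gE nd]]]; exists m.+1, h; split => //.
by rewrite fE gE exprS mulrA.
Qed.

Definition point_place a : place (meromorphic v) :=
  prime_place (entireXsubC_prime a) (@entireXsubC_finite_order a).

End EntirePrime.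

(** * Zeros of entire functions *)

Section Zeros.
Variables (R : realType) (K : closedFieldType) (v : nonarch_absval R K).
Variable (K_complete : absval_complete v).
Implicit Types (f g : entire v) (a : K).

Lemma seq_min (T : eqType) (F : T -> R) (s : seq T) : s != [::] ->
  exists2 x, x \in s & forall y, y \in s -> F x <= F y.
Proof.
elim: s => // x [_ _|y s IH _].
  by exists x; rewrite ?inE// => y; rewrite inE => /eqP ->.
have [//|z zs hz] := IH; have [xz|zx] := leP (F x) (F z).
  exists x; rewrite ?inE ?eqxx// => w; rewrite inE => /orP[/eqP->//|/hz].
  exact: le_trans.
exists z; first by rewrite inE zs orbT.
by move=> w; rewrite inE => /orP[/eqP->|/hz//]; exact: ltW.
Qed.

(** Compare the value at [x] of a product of factors [X - y] with its norm: a
    factor with [y] in the disc has norm [r] and value at least [t * r], a factor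
    with [y] outside has the same norm and absolute value at [x]. *)
Lemma prod_value_ge (r t : R) (x : K) (s : seq K) : 0 < r -> v x <= r ->
  0 <= t -> (forall y, y \in s -> v y <= r -> t * r <= v (x - y)) ->
  let q := entire_poly v (\prod_(y <- s) ('X - y%:P)) in
  [/\ q != 0, t ^+ peak r q * gauss r q <= v (\prod_(y <- s) (x - y))
    & (0 < peak r q)%N -> exists2 y, y \in s & v y <= r].
Proof.
move=> r0 xr t0; elim: s => [|y s IH] h /=.
  rewrite !big_nil; have -> : entire_poly v 1 = entireC v 1 by [].
  have [-> ->] := peakC v r0 (oner_neq0 K).
  by rewrite absval1 rmorph1 expr0 mulr1 oner_neq0 lexx.
have [|q0 hq ex] := IH; first by move=> z zs; apply: h; rewrite inE zs orbT.
rewrite !big_cons entire_polyM; set q := entire_poly v _ in q0 hq ex *.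
rewrite -/(entireXsubC v y); have l0 := entireXsubC_neq0 v y.
have [-> ->] := peakM r0 l0 q0; have [-> ->] := gauss_entireXsubC v y r0.
rewrite absvalM exprD mulrACA mulf_neq0//; split => //.
  apply: ler_pM => //; try by rewrite mulr_ge0 ?exprn_ge0 ?gauss_ge0 ?le_max ?(ltW r0).
  have [yr|ry] := leP (v y) r; first by rewrite expr1 h// inE eqxx.
  by rewrite expr0 mul1r absvalBC absval_addl// absvalN (le_lt_trans xr).
have [yr _|_ /ex[z zs zr]] := leP (v y) r; first by exists y => //; rewrite inE eqxx.
by exists z => //; rewrite inE zs orbT.
Qed.

(** Where a polynomial is small, a root is near: take the closest root in the
    disc, and apply [prod_value_ge] to its relative distance to [x]. *)
Lemma poly_root_near (r : R) (p : {poly K}) (x : K) : 0 < r -> v x <= r ->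
  let q := entire_poly v p in p != 0 -> (0 < peak r q)%N ->
  exists y, [/\ root p y, v y <= r &
    (v (x - y) / r) ^+ peak r q * gauss r q <= v p.[x]].
Proof.
move=> r0 xr /= p0; have [s pE] := closed_field_poly_normal p.
set c := lead_coef p in pE; have c0 : c != 0 by rewrite lead_coef_eq0.
have pE' : entire_poly v p = entireC v c * entire_poly v (\prod_(y <- s) ('X - y%:P)).
  by rewrite {1}pE -mul_polyC entire_polyM.
have C0 : entireC v c != 0.
  apply/eqP => e; have := (peakC v r0 c0).2; rewrite e gauss0 => /esym/eqP.
  by rewrite absval_eq0 (negPf c0).
have [|q0 _ ex] := prod_value_ge (s := s) r0 xr (lexx 0).
  by move=> *; rewrite mul0r absval_ge0.
rewrite pE'; have [-> ->] := peakM r0 C0 q0; have [-> ->] := peakC v r0 c0.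
rewrite add0n => /ex[y0 y0s y0r].
have y0f : y0 \in [seq y <- s | v y <= r] by rewrite mem_filter y0r.
have [|y] := @seq_min _ (fun y => v (x - y)) [seq y <- s | v y <= r].
  by apply: contraTneq y0f => ->.
rewrite mem_filter => /andP[yr ys] hy; exists y; split => //.
  rewrite pE rootZ// root_prod_XsubC//.
have [||_] := prod_value_ge (s := s) (t := v (x - y) / r) r0 xr.
- by rewrite divr_ge0 ?absval_ge0 ?ltW.
- by move=> z zs zr; rewrite divfK ?gt_eqF// hy// mem_filter zr zs.
move=> hq _; rewrite pE hornerZ absvalM mulrCA ler_wpM2l ?absval_ge0//.
apply: le_trans hq _; rewrite horner_prod.
by under [in X in _ <= X]eq_bigr do rewrite hornerXsubC.
Qed.

End Zeros.

Section ZeroExistence.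
Variables (R : realType) (K : closedFieldType) (v : nonarch_absval R K).
Variable (K_complete : absval_complete v).
Implicit Types (f g : entire v) (a : K).

Definition truncation f n : {poly K} := \poly_(i < n) f i.

Lemma horner_truncation f n x : (truncation f n).[x] = \sum_(j < n) f j * x ^+ j.
Proof. exact: horner_poly. Qed.

(** Because [a ^ j - b ^ j] is a multiple of [a - b]. *)
Lemma truncation_lipschitz (r : R) f n x y : 0 < r -> v x <= r -> v y <= r ->
  v ((truncation f n).[x] - (truncation f n).[y]) <= gauss r f / r * v (x - y).
Proof.
move=> r0 xr yr; rewrite !horner_truncation -sumrB.
have M0 : 0 <= gauss r f / r * v (x - y).
  by rewrite mulr_ge0 ?absval_ge0// divr_ge0 ?gauss_ge0 ?(ltW r0).
apply: (absval_sum_le (F := fun j => f j * x ^+ j - f j * y ^+ j)) => // -[|j] _.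
  by rewrite subrr absval0.
rewrite -mulrBr subrXX mulrCA absvalM mulrC ler_wpM2r ?absval_ge0//.
rewrite ler_pdivlMr//; apply: le_trans (term_le r0 f j.+1).
rewrite absvalM -mulrA ler_wpM2l ?absval_ge0// exprSr ler_wpM2r ?(ltW r0)//.
apply: (absval_sum_le (F := fun i => x ^+ (j.+1.-1 - i) * y ^+ i)).
  by rewrite exprn_ge0 ?(ltW r0).
move=> i; rewrite ltnS => ij; rewrite absvalM !absvalX /= -{2}(subnK ij) exprD.
by rewrite ler_pM ?exprn_ge0 ?absval_ge0// lerXn2r ?nnegrE ?absval_ge0 ?(ltW r0).
Qed.

(** The norm is already reached by the coefficients kept in the truncation. *)
Lemma truncation_peak (r : R) f n : 0 < r -> f != 0 -> (peak r f < n)%N ->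
  [/\ truncation f n != 0, peak r (entire_poly v (truncation f n)) = peak r f
    & gauss r (entire_poly v (truncation f n)) = gauss r f].
Proof.
move=> r0 f0 kn; have [fk fk'] := peakP r0 f0.
have tE i : entire_poly v (truncation f n) i = if (i < n)%N then f i else 0.
  by rewrite /= coef_poly.
have fk0 : f (peak r f) != 0 by apply: (is_peak_neq0 r0 f0); exact: peakP.
have t0 : truncation f n != 0.
  by apply: contraNneq fk0 => e; have := tE (peak r f); rewrite kn e /= coef0 => <-.
have T0 : entire_poly v (truncation f n) != 0.
  apply/eqP => e; have := tE (peak r f).
  by rewrite kn e coef_entire0 => /esym/eqP; rewrite (negPf fk0).
have tt i : term r (entire_poly v (truncation f n)) i =
    if (i < n)%N then term r f i else 0.
  by rewrite /term tE; case: ifP => // _; rewrite absval0 mul0r.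
have tk : term r (entire_poly v (truncation f n)) (peak r f) = gauss r f.
  by rewrite tt kn.
suff /(is_peakE r0 T0)[-> ->] :
  is_peak r (entire_poly v (truncation f n)) (peak r f) by [].
by split=> i; rewrite tk tt; case: ifP => // _; rewrite ?gauss_ge0 ?gauss_gt0//;
  exact: fk'.
Qed.

(** Each truncation has a root close to a given root of the previous one, where
    its value is the single term added. These roots form a Cauchy sequence, whose
    limit is a zero of [f]. *)
Lemma entire_zero (r : R) f : 0 < r -> f != 0 -> (0 < peak r f)%N ->
  exists2 a, v a <= r & divides (entireXsubC v a) f.
Proof.
move=> r0 f0; set k := peak r f => k0; have G0 := gauss_gt0 r0 f0.
pose t n := truncation f (k + n.+1).
have tP n : [/\ t n != 0, peak r (entire_poly v (t n)) = k
    & gauss r (entire_poly v (t n)) = gauss r f].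
  by apply: truncation_peak => //; rewrite -/k addnS ltnS leq_addr.
pose next n x y := [/\ root (t n) y, v y <= r &
  (v (x - y) / r) ^+ k * gauss r f <= v (t n).[x]].
have nextP n x : exists y, v x <= r -> next n x y.
  have [xr|rx] := boolP (v x <= r); last by exists 0.
  have [t0 tk tg] := tP n; have := @poly_root_near _ _ v r (t n) x r0 xr t0.
  by rewrite tk tg => /(_ k0)[y hy]; exists y.
(* [X n.+1] is a root of [t n], chosen close to [X n] *)
pose X := fix X n : K := if n is m.+1 then projT1 (cid (nextP m (X m))) else 0.
have XS n : v (X n) <= r -> next n (X n) (X n.+1).
  by move=> h /=; case: cid => y /= /(_ h).
have Xr n : v (X n) <= r.
  by elim: n => [|n /XS[]//]; rewrite /= absval0 ltW.
have Xroot n : (t n).[X n.+1] = 0 by have [/rootP] := XS n (Xr n).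
(* at a root of the previous truncation only the added term remains *)
have Xdiff n : (v (X n.+1 - X n.+2) / r) ^+ k * gauss r f <= term r f (k + n.+1).
  have [_ _ h] := XS n.+1 (Xr n.+1); apply: le_trans h _.
  have -> : (t n.+1).[X n.+1] = (t n).[X n.+1] + f (k + n.+1)%N * X n.+1 ^+ (k + n.+1).
    by rewrite !horner_truncation addnS big_ord_recr.
  rewrite Xroot add0r absvalM absvalX /term ler_wpM2l ?absval_ge0//.
  by rewrite lerXn2r ?nnegrE ?absval_ge0 ?(ltW r0)//; exact: Xr.
have X0 : tends v (fun n => X n.+2 - X n.+1) 0.
  move=> e e0; have c0 : 0 < (e / r) ^+ k * gauss r f.
    by rewrite mulr_gt0// exprn_gt0// divr_gt0.
  have [N hN] := entire_bound (entireP f) r0 c0; exists N => n Nn.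
  rewrite subr0 absvalBC.
  have : term r f (k + n.+1) < (e / r) ^+ k * gauss r f.
    by apply: hN; rewrite (leq_trans Nn)// addnS ltnW// ltnS leq_addl.
  move=> /(le_lt_trans (Xdiff n)); rewrite ltr_pM2r//.
  rewrite ltr_pXn2r ?nnegrE ?divr_ge0 ?absval_ge0 ?(ltW r0) ?(ltW e0)//.
  by rewrite ltr_pM2r ?invr_gt0.
have [l hl] := tends_series K_complete X0.
have ha := tends_affine (X 1%N) 1 hl; rewrite mul1r in ha; set a := _ + l in ha.
have XE n : X 1%N + 1 * \sum_(j < n) (X j.+2 - X j.+1) = X n.+1.
  rewrite mul1r; elim: n => [|n IH]; first by rewrite big_ord0 addr0.
  by rewrite big_ord_recr addrA IH addrC subrK.
have ar : v a <= r by apply: tends_le ha _ => n; rewrite XE Xr.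
exists a => //; apply/(divides_evalf K_complete).
apply: tends_uniq (evalf_lim K_complete f a) _ => e e0.
have C0 : 0 < gauss r f / r by rewrite divr_gt0.
have [N hN] := ha _ (divr_gt0 e0 C0); exists (k + N.+1)%N => n Nn.
have [m nE Nm] : exists2 m, n = (k + m.+1)%N & (N <= m)%N.
  by exists (n - k.+1)%N; lia.
rewrite subr0 -horner_truncation nE -/(t m) -[_.[a]]subr0 -(Xroot m).
apply: le_lt_trans (truncation_lipschitz f (k + m.+1) r0 ar (Xr m.+1)) _.
by rewrite mulrC -ltr_pdivlMr// absvalBC -XE hN.
Qed.

Lemma gauss_mono (r s : R) f : 0 < s -> s <= r -> gauss s f <= gauss r f.
Proof.
move=> s0 sr; have r0 := lt_le_trans s0 sr.
apply: gauss_le => n; apply: le_trans (term_le r0 f n).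
by rewrite /term ler_wpM2l ?absval_ge0// lerXn2r ?nnegrE ?(ltW s0) ?(ltW r0).
Qed.

(** Without zeros in the disc of radius [r], the norms on all smaller discs are
    that of the constant term. *)
Lemma gauss_peak0 (r s : R) f : 0 < s -> s <= r -> f != 0 -> peak r f = 0%N ->
  gauss s f = gauss r f.
Proof.
move=> s0 sr f0 k0; apply/le_anti/andP; split; first exact: gauss_mono.
have := term_le s0 f 0; apply: le_trans; rewrite /gauss k0 /term.
by rewrite !expr0.
Qed.

(** Maximum principle: the zeros of the denominator in the disc of radius [r] are
    zeros of the numerator as there are no poles, and can be simplified. The norm
    of the remaining denominator is the same on both discs, whereas that of the
    numerator increases. *)
Lemma gauss_absval_regular (r s : R) (r0 : 0 < r) (s0 : 0 < s)
    (x : meromorphic v) : s <= r -> x != 0 ->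
  (forall a, 0 <= point_place K_complete a x) ->
  gauss_absval v s0 x <= gauss_absval v r0 x.
Proof.
move=> sr; move: x; apply: frac_ind => u w.
elim: {w}_.+1 {-2}w (ltnSn (peak r w)) u => // n IH w wn u w0 x0 hx.
have u0 : u != 0 by apply: contraNneq x0 => ->; rewrite tofrac0 mul0r.
have [wk|] := posnP (peak r w).
  rewrite !gauss_absvalE// (gauss_peak0 s0 sr w0 wk).
  by rewrite ler_wpM2r ?invr_ge0 ?gauss_ge0// gauss_mono.
move=> /(entire_zero r0 w0)[a ar [w' wE]].
have pa := entireXsubC_neq0 v a.
have w'0 : w' != 0 by apply: contraNneq w0 => e; rewrite wE e mulr0.
have : divides (entireXsubC v a) u.
  have da := entireXsubC_prime K_complete a; have fa := @entireXsubC_finite_order _ _ v a.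
  apply/(prime_place_gt0 da fa u0).
  have w1 : 1 <= prime_place da fa w%:F by apply/prime_place_gt0 => //; exists w'.
  have := hx a; rewrite /point_place ord_div ?tofrac_eq0// subr_ge0.
  exact: le_trans.
move=> [u' uE].
have xE : u%:F / w%:F = u'%:F / w'%:F.
  apply/eqP; rewrite eqr_div ?tofrac_eq0// -!tofracM tofrac_eq uE wE.
  by apply/eqP; ring.
rewrite xE in x0 hx *; suff wn' : (peak r w' < n)%N by exact: (IH _ wn' _ w'0 x0 hx).
move: wn; rewrite wE (peakM r0 pa w'0).1 (gauss_entireXsubC v a r0).1 ar.
by rewrite add1n ltnS.
Qed.

End ZeroExistence.

(** * Derivatives of meromorphic functions *)

Section EntireDerivative.
Variables (R : realType) (K : fieldType) (v : nonarch_absval R K).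
Implicit Types (f g : entire v).

Lemma is_entire_deriv f : is_entire v (fun n => f n.+1 *+ n.+1).
Proof.
apply: is_entire_bound => r e r0 e0.
have [N hN] := entire_bound (entireP f) r0 (mulr_gt0 e0 r0).
exists N => n Nn; rewrite -(ler_pM2r r0) -mulrA -exprSr.
apply: le_trans (ltW (hN n.+1 (leqW Nn))).
rewrite ler_wpM2r ?exprn_ge0 ?(ltW r0)// -mulr_natl absvalM.
by rewrite ler_piMl ?absval_ge0 ?absval_nat.
Qed.

Definition entire_deriv f : entire v := mk_entire (is_entire_deriv f).

Lemma entire_derivation : derivation entire_deriv.
Proof.
split=> f g; apply: eq_entire => n; first by rewrite /= mulrnDl.
(* Leibniz' rule for polynomials that agree with [f] and [g] up to [n.+1] *)
pose T (h : entire v) := \poly_(i < n.+2) h i.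
have coefT (h : entire v) i : (i <= n.+1)%N -> (T h)`_i = h i.
  by move=> ih; rewrite coef_poly ltnS ih.
have coefTM (h k : entire v) m (p q : {poly K}) : (m <= n.+1)%N ->
    (forall i, (i <= m)%N -> p`_i = h i) ->
    (forall i, (i <= m)%N -> q`_i = k i) -> (p * q)`_m = (h * k) m.
  move=> mn ph qk; rewrite coefM coef_entireM; apply: eq_bigr => i _.
  by rewrite ph ?qk ?leq_subr// -ltnS.
have dT h i : (i <= n)%N -> (T h)^`()`_i = entire_deriv h i.
  by move=> ni; rewrite coef_deriv coefT.
have -> : entire_deriv (f * g) n = (T f * T g)^`()`_n.
  by rewrite coef_deriv (coefTM f g)// => i ni; rewrite coefT// (leq_trans ni).
rewrite derivM coefD coef_entireD (coefTM (entire_deriv f) g) ?(coefTM f (entire_deriv g))//;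
  by move=> i ni; rewrite ?dT ?coefT// ltnW.
Qed.

Lemma entire_deriv_XsubC a : entire_deriv (entireXsubC v a) = 1.
Proof.
apply: eq_entire => n; rewrite coef_entire1 /= coefB coefX coefC /= subr0 eqSS.
by case: n => [|n]; rewrite ?mul0rn.
Qed.

Definition mero_deriv : meromorphic v -> meromorphic v := fderiv entire_deriv.

Lemma mero_derivation : derivation mero_deriv.
Proof. exact: fderiv_derivation entire_derivation. Qed.

Lemma mero_deriv_const c : mero_deriv (meroC v c) = 0.
Proof.
rewrite /mero_deriv /meroC /= (fderiv_tofrac entire_derivation).
apply/eqP; rewrite tofrac_eq0; apply/eqP/entire_eq0 => n.
by rewrite /= coefC /= mul0rn.
Qed.

Lemma gaussN (r : R) f : 0 < r -> gauss r (- f) = gauss r f.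
Proof.
move=> r0; have h (g : entire v) : gauss r (- g) <= gauss r g.
  apply: gauss_le => n; apply: le_trans (term_le r0 g n).
  by rewrite /term coef_entireN absvalN.
by apply/le_anti; rewrite h -{1}[f]opprK h.
Qed.

Lemma gauss_deriv (r : R) f : 0 < r -> gauss r (entire_deriv f) <= gauss r f / r.
Proof.
move=> r0; apply: gauss_le => n; rewrite ler_pdivlMr//.
apply: le_trans (term_le r0 f n.+1).
rewrite /term -mulrA -exprSr ler_wpM2r ?exprn_ge0 ?(ltW r0)//=.
by rewrite -mulr_natl absvalM ler_piMl ?absval_ge0 ?absval_nat.
Qed.

(** The bound on coefficients passes to the quotients by the quotient rule. *)
Lemma gauss_mero_deriv (r : R) (r0 : 0 < r) (x : meromorphic v) :
  gauss_absval v r0 (mero_deriv x) <= gauss_absval v r0 x / r.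
Proof.
move: x; apply: frac_ind => u w w0.
rewrite /mero_deriv (fderivE entire_derivation)// !gauss_absvalE ?expf_neq0//.
have gw := gauss_gt0 r0 w0.
rewrite expr2 gaussM// ler_pdivrMr; last exact: (mulr_gt0 gw gw).
have -> : gauss r u / gauss r w / r * (gauss r w * gauss r w) =
  gauss r u * gauss r w / r by field; rewrite !gt_eqF.
have gD (a b : entire v) :
    gauss r (entire_deriv a * b) <= gauss r a * gauss r b / r.
  by rewrite gaussM// [leRHS]mulrAC ler_wpM2r ?gauss_ge0// gauss_deriv.
have gN : gauss r (- (u * entire_deriv w)) = gauss r (entire_deriv w * u).
  by rewrite gaussN// mulrC.
rewrite (le_trans (gaussD r0 _ _))// ge_max gD gN.
by rewrite [X in X / r]mulrC; exact: gD.
Qed.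

End EntireDerivative.

(** * Orders of the test function *)

(** The properties of the place of a point of the line on which the count of
    orders relies, with [iota] the embedding of constants: the residue field is
    [K] and [D] is the derivation with respect to a parameter. *)
Record geometric_place (K F : fieldType) (iota : K -> F) (D : F -> F)
    (o : place F) : Prop := GeometricPlace {
  ord_const : forall c, c != 0 -> o (iota c) = 0;
  ord_residue : forall x, x != 0 -> 0 <= o x ->
    exists c, x = iota c \/ 1 <= o (x - iota c);
  ord_deriv : forall x, x != 0 -> o x != 0 -> D x != 0 /\ o (D x) = o x - 1 }.

Definition nonconstant (K F : Type) (iota : K -> F) (x : F) :=
  ~ exists c, x = iota c.

Definition value_mult (K : fieldType) (P : {poly K}) (x : K) : nat :=
  mup x (P - P.[x]%:P).

(** If [f] takes the value [a] with multiplicity [m] and [g] the value [b] with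
    multiplicity [n] at the same point, then [P(f) = P(g)] forces
    [value_mult P a * m = value_mult P b * n]; if [a] is in [B] and
    [b != a], the two bounds exclude [n = 1]. *)
Definition separated_values (K : fieldType) (P : {poly K}) (B : seq K) :=
  forall a b, a \in B -> b != a -> P.[b] = P.[a] ->
    value_mult P b != value_mult P a /\
    (value_mult P b < 2 * value_mult P a)%N.

(** The square is what the points where [f] and [g] take distinct values [a] and
    [b] of the set require: there [f'] and [f - a] contribute
    [2 * (m - 1) - m = m - 2], with [m >= 2], and so do [g'] and [g - b]. *)
Definition test_fun (K F : fieldType) (iota : K -> F) (D : F -> F) (B : seq K)
    (f g : F) : F :=
  (D f * D g * (f - g)) ^+ 2 /
  ((\prod_(d <- B) (f - iota d)) * \prod_(d <- B) (g - iota d)).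

Section LocalAnalysis.
Variables (K : closedFieldType) (F : fieldType) (iota : {rmorphism K -> F}).
Variables (D : F -> F) (derD : derivation D) (D_const : forall c, D (iota c) = 0).
Variables (o : place F) (geo : geometric_place iota D o).
Implicit Types (x f g : F) (a b c : K) (P Q : {poly K}).

Lemma nonconstant_sub x c : nonconstant iota x -> x - iota c != 0.
Proof. by move=> nx; rewrite subr_eq0; apply/eqP => xE; apply: nx; exists c. Qed.

Lemma nonconstant_neq0 x : nonconstant iota x -> x != 0.
Proof. by move=> /(@nonconstant_sub x 0); rewrite rmorph0 subr0. Qed.

Lemma prod_sub_neq0 (B : seq K) x : nonconstant iota x ->
  \prod_(d <- B) (x - iota d) != 0.
Proof.
by move=> nx; rewrite prodf_seq_neq0; apply/allP => d _; exact: nonconstant_sub.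
Qed.

Lemma map_poly_factored (c : K) (s : seq K) x :
  (map_poly iota (c *: \prod_(d <- s) ('X - d%:P))).[x] =
  iota c * \prod_(d <- s) (x - iota d).
Proof.
rewrite map_polyZ hornerZ rmorph_prod /= horner_prod; congr (_ * _).
by apply: eq_bigr => d _; rewrite map_polyXsubC hornerXsubC.
Qed.

Lemma ord_poly Q x : Q != 0 -> nonconstant iota x ->
  exists s : seq K, [/\ Q = lead_coef Q *: \prod_(d <- s) ('X - d%:P) &
    o (map_poly iota Q).[x] = \sum_(d <- s) o (x - iota d)].
Proof.
move=> Q0 nx; have [s QE] := closed_field_poly_normal Q; exists s; split=> //.
have c0 : lead_coef Q != 0 by rewrite lead_coef_eq0.
rewrite {1}QE map_poly_factored ordM ?prod_sub_neq0 ?fmorph_eq0//.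
rewrite (ord_const geo) // add0r ord_prod// => d.
exact: nonconstant_sub.
Qed.

Lemma ord_pole x c : nonconstant iota x -> o x < 0 -> o (x - iota c) = o x.
Proof.
move=> nx x0; have [->|c0] := eqVneq c 0; first by rewrite rmorph0 subr0.
apply: (ordD_lt (nonconstant_neq0 nx) _ _).2.
  by rewrite oppr_eq0 fmorph_eq0.
by rewrite ordN (ord_const geo).
Qed.

(** All factors [x - iota d] have the order of [x]. *)
Lemma ord_poly_pole Q x : Q != 0 -> nonconstant iota x -> o x < 0 ->
  o (map_poly iota Q).[x] = (size Q).-1%:Z * o x.
Proof.
move=> Q0 nx x0; have [s [QE ->]] := ord_poly Q0 nx.
have c0 : lead_coef Q != 0 by rewrite lead_coef_eq0.
have -> : (size Q).-1 = size s by rewrite QE size_scale// size_prod_XsubC.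
elim: (s) => [|d t IH]; first by rewrite big_nil mul0r.
by rewrite big_cons IH ord_pole//=; lia.
Qed.

Lemma ord_poly_ge0 Q x : Q != 0 -> nonconstant iota x -> 0 <= o x ->
  0 <= o (map_poly iota Q).[x].
Proof.
move=> Q0 nx x0; have [s [_ ->]] := ord_poly Q0 nx; apply: sumr_ge0 => d _.
have [->|d0] := eqVneq d 0; first by rewrite rmorph0 subr0.
apply: ordB_ge; rewrite ?(nonconstant_neq0 nx) ?nonconstant_sub ?fmorph_eq0//.
by rewrite (ord_const geo).
Qed.

Lemma ord_center x a b : nonconstant iota x -> 1 <= o (x - iota a) -> b != a ->
  o (x - iota b) = 0.
Proof.
move=> nx xa ba; have ab : a - b != 0 by rewrite subr_eq0 eq_sym.
have -> : x - iota b = iota (a - b) + (x - iota a) by rewrite rmorphB; ring.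
rewrite (ordD_lt _ _ _).2 ?(ord_const geo) ?fmorph_eq0 ?nonconstant_sub//.
Qed.

(** Only the factors [x - iota a] vanish where [x] takes the value [a]. *)
Lemma ord_poly_center Q x a : Q != 0 -> nonconstant iota x ->
  1 <= o (x - iota a) -> o (map_poly iota Q).[x] = (mup a Q)%:Z * o (x - iota a).
Proof.
move=> Q0 nx xa; have [s [QE ->]] := ord_poly Q0 nx.
have c0 : lead_coef Q != 0 by rewrite lead_coef_eq0.
have -> : mup a Q = count_mem a s.
  by rewrite QE -mul_polyC mupMr ?rootC// mu_prod_XsubC.
elim: (s) => [|d t IH]; first by rewrite big_nil mul0r.
rewrite big_cons IH /=; have [->|da] := eqVneq d a; first by lia.
by rewrite (ord_center nx xa da); lia.
Qed.

Lemma sum_ord_center (B : seq K) x a : uniq B -> nonconstant iota x ->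
  1 <= o (x - iota a) ->
  \sum_(d <- B) o (x - iota d) = if a \in B then o (x - iota a) else 0.
Proof.
move=> uB nx xa; case: ifPn => aB.
  rewrite (bigD1_seq a)//= big1 ?addr0// => d da; exact: ord_center xa da.
rewrite big_seq big1// => d dB; apply: ord_center xa _ => //.
by apply: contraNneq aB => <-.
Qed.

Lemma ord_deriv_center x a : nonconstant iota x -> 1 <= o (x - iota a) ->
  D x != 0 /\ o (D x) = o (x - iota a) - 1.
Proof.
move=> nx xa; have -> : D x = D (x - iota a) by rewrite derDB// D_const subr0.
by apply: (ord_deriv geo); [exact: nonconstant_sub|rewrite gt_eqF// (lt_le_trans _ xa)].
Qed.

Lemma residue_ex x : nonconstant iota x -> 0 <= o x ->
  exists a, 1 <= o (x - iota a).
Proof.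
move=> nx /(ord_residue geo (nonconstant_neq0 nx))[c [xE|]]; last by exists c.
by case: nx; exists c.
Qed.

(** Local at any one place: [x] has a pole, or [x - iota a] a zero, of nonzero
    order, which the derivative lowers by one. *)
Lemma nonconstant_deriv x : nonconstant iota x -> D x != 0.
Proof.
move=> nx; have [x0|x0] := ltP (o x) 0.
  by have [] := ord_deriv geo (nonconstant_neq0 nx); rewrite ?lt_eqF.
by have [a /(ord_deriv_center nx)[]] := residue_ex nx x0.
Qed.

Lemma ord_test_fun (B : seq K) f g :
  nonconstant iota f -> nonconstant iota g -> f != g ->
  test_fun iota D B f g != 0 /\
  o (test_fun iota D B f g) = (o (D f) + o (D g) + o (f - g)) * 2 -
    (\sum_(d <- B) o (f - iota d) + \sum_(d <- B) o (g - iota d)).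
Proof.
move=> nf ng fg; have Df := nonconstant_deriv nf; have Dg := nonconstant_deriv ng.
have fg0 : f - g != 0 by rewrite subr_eq0.
have Bf := prod_sub_neq0 B nf; have Bg := prod_sub_neq0 B ng.
split; first by rewrite /test_fun !mulf_neq0 ?invr_eq0 ?mulf_neq0.
rewrite /test_fun ord_div ?expf_neq0 ?mulf_neq0// ordX ?mulf_neq0//.
rewrite !ordM ?mulf_neq0// !ord_prod// => d; exact: nonconstant_sub.
Qed.

Section SharedValues.
Variables (P : {poly K}) (f g : F).
Hypotheses (P_size : (1 < size P)%N).
Hypotheses (nf : nonconstant iota f) (ng : nonconstant iota g) (fg : f != g).
Hypothesis PfPg : (map_poly iota P).[f] = (map_poly iota P).[g].

Let shifted (c : K) : {poly K} := P - c%:P.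

Let size_shifted c : size (shifted c) = size P.
Proof. by rewrite size_polyDl// size_polyN (leq_ltn_trans (size_polyC_leq1 c)). Qed.

Let shifted_neq0 c : shifted c != 0.
Proof. by rewrite -size_poly_gt0 size_shifted ltnW. Qed.

Let shifted_eq c : (map_poly iota (shifted c)).[f] = (map_poly iota (shifted c)).[g].
Proof. by rewrite !rmorphB /= !hornerD PfPg !hornerN map_polyC !hornerC. Qed.

Lemma value_mult_gt0 a : (0 < value_mult P a)%N.
Proof.
by rewrite -(XsubC_dvd _ (shifted_neq0 _)) dvdp_XsubCl rootE !hornerE subrr.
Qed.

Lemma shared_pole : o f < 0 -> o g = o f.
Proof.
move=> f0; have := shifted_eq 0 => /(congr1 o).
rewrite ord_poly_pole// size_shifted => e.
have n0 : 0 < (size P).-1%:Z by lia.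
have [g0|g0] := ltP (o g) 0; last first.
  by have := ord_poly_ge0 (shifted_neq0 0) ng g0; rewrite -e; nia.
by move: e; rewrite ord_poly_pole// size_shifted => /(mulfI (lt0r_neq0 n0)).
Qed.

(** Both sides are the order of [P(f) - P(a) = P(g) - P(a)]; as this is positive,
    [b] must be a root of [P - P(a)]. *)
Lemma shared_center a b : 1 <= o (f - iota a) -> 1 <= o (g - iota b) ->
  P.[b] = P.[a] /\
  (value_mult P a)%:Z * o (f - iota a) = (value_mult P b)%:Z * o (g - iota b).
Proof.
move=> fa gb; have := shifted_eq P.[a] => /(congr1 o).
rewrite (ord_poly_center (shifted_neq0 _) nf fa).
rewrite (ord_poly_center (shifted_neq0 _) ng gb) => e.
suff ba : P.[b] = P.[a] by split; [exact: ba | rewrite /value_mult ba; exact: e].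
have ma : (0 < mup a (shifted P.[a]))%N by exact: value_mult_gt0.
have : root (shifted P.[a]) b.
  apply: contraT => /mupNroot mb; move: e; rewrite mb mul0r => /eqP.
  by rewrite mulf_eq0; lia.
by rewrite rootE !hornerE subr_eq0 => /eqP.
Qed.

(** If [n = 1], then [mu_b = m * mu_a < 2 * mu_a] imposes [m = 1] and
    [mu_b = mu_a]. *)
Lemma separated_ramified (B : seq K) a b (m n : int) : separated_values P B ->
  a \in B -> b != a -> P.[b] = P.[a] -> 1 <= m -> 1 <= n ->
  (value_mult P a)%:Z * m = (value_mult P b)%:Z * n -> 2 <= n.
Proof.
move=> sep aB ba Pba m1 n1 e; have [/eqP ne lt] := sep a b aB ba Pba.
rewrite leNgt; apply/negP => n2; have n1' : n = 1 by lia.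
move: e; rewrite n1' mulr1 => e.
have [m1'|m2] := eqVneq m 1; first by apply: ne; move: e; rewrite m1'; lia.
suff : 2 <= m by nia.
by lia.
Qed.

(** With [m] and [n] the multiplicities of the values [a] of [f] and [b] of [g],
    the order is at least [4 * (m - 1)] if [a = b]; otherwise a value in [B] costs
    [m] or [n], which the derivatives pay for by [separated_ramified]. At a pole
    of order [p] it is at least [(2 * size B - 6) * p - 4]. *)
Lemma test_fun_regular (B : seq K) : uniq B -> separated_values P B ->
  0 <= o f \/ (5 <= size B)%N -> 0 <= o (test_fun iota D B f g).
Proof.
move=> uB sep hB; rewrite (ord_test_fun B nf ng fg).2.
have fg0 : f - g != 0 by rewrite subr_eq0.
have [f0 g0] := (nonconstant_neq0 nf, nonconstant_neq0 ng).
have [fneg|fpos] := ltP (o f) 0.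
  have gE := shared_pole fneg.
  have ofg : o f <= o (f - g) by apply: ordB_ge; rewrite ?gE.
  have [_ oDf] := ord_deriv geo f0 (negbT (lt_eqF fneg)).
  have [_ oDg] : D g != 0 /\ o (D g) = o g - 1.
    by apply: (ord_deriv geo g0); rewrite gE lt_eqF.
  have S x : nonconstant iota x -> o x = o f ->
      \sum_(d <- B) o (x - iota d) = (size B)%:Z * o f.
    move=> nx xE; elim: (B) => [|d t IH]; first by rewrite big_nil mul0r.
    by rewrite big_cons IH ord_pole ?xE//=; lia.
  rewrite (S f)// (S g)// oDf oDg gE.
  case: hB => hB; first by lia.
  by nia.
have gpos : 0 <= o g.
  rewrite leNgt; apply/negP => gneg.
  have e := shifted_eq 0; have := ord_poly_ge0 (shifted_neq0 0) nf fpos.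
  by rewrite e ord_poly_pole// size_shifted; nia.
have [a fa] := residue_ex nf fpos; have [b gb] := residue_ex ng gpos.
have [Pba mE] := shared_center fa gb.
have [_ ->] := ord_deriv_center nf fa; have [_ ->] := ord_deriv_center ng gb.
rewrite (sum_ord_center uB nf fa) (sum_ord_center uB ng gb).
have ofg : 0 <= o (f - g) by apply: ordB_ge.
have fa2 : b != a -> a \in B -> 2 <= o (g - iota b).
  by move=> ba aB; exact: (separated_ramified sep aB ba Pba fa gb mE).
have gb2 : b != a -> b \in B -> 2 <= o (f - iota a).
  rewrite eq_sym => ab bB.
  exact: (separated_ramified sep bB ab (esym Pba) gb fa (esym mE)).
have [ba|ba] := eqVneq b a; last first.
  move: (fa2 ba) (gb2 ba); case: ifP => aB; case: ifP => bB; lia.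
move: mE; rewrite ba => mE.
have ma : (value_mult P a)%:Z != 0.
  by have := value_mult_gt0 a; lia.
move/(mulfI ma): mE => mE; rewrite -ba in mE *.
have : o (f - iota b) <= o (f - g).
  have -> : f - g = (f - iota b) - (g - iota b) by ring.
  apply: ordB_ge; rewrite ?nonconstant_sub -?mE ?ba//.
  by rewrite opprB addrA subrK.
by rewrite -mE; case: ifP => _; lia.
Qed.

End SharedValues.
End LocalAnalysis.

(** * Growth of the test function *)

Section Growth.
Variables (R : realType) (K : closedFieldType) (v : nonarch_absval R K).
Implicit Types (B s : seq K).

Lemma absval_seq_bound s : exists2 M : R, 1 <= M & forall d, d \in s -> v d <= M.
Proof.
exists (1 + \sum_(d <- s) v d); first by rewrite lerDl sumr_ge0// => *; exact: absval_ge0.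
elim: s => // c s IH d; rewrite inE big_cons => /orP[/eqP->|/IH h].
  rewrite addrCA lerDl addr_ge0// sumr_ge0// => *; exact: absval_ge0.
by rewrite (le_trans h)// lerD2l lerDr absval_ge0.
Qed.

Lemma absval_seq_gap s : exists2 e : R, 0 < e <= 1 &
  forall c d, c \in s -> d \in s -> c != d -> e <= v (c - d).
Proof.
pose t := 1 :: [seq x <- [seq v (c - d) | c <- s, d <- s] | 0 < x].
have [//|e et he] := @seq_min R _ id t.
exists e => [|c d cs ds cd].
  rewrite (he 1) ?inE ?eqxx// andbT.
  by move: et; rewrite inE => /orP[/eqP->//|]; rewrite mem_filter => /andP[].
apply: he; rewrite inE mem_filter absval_gt0 subr_eq0 cd /= orbC.
by rewrite (allpairs_f (fun c d => v (c - d))).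
Qed.

Variables (F : fieldType) (iota : {rmorphism K -> F}) (D : F -> F).
Hypotheses (derD : derivation D) (D_const : forall c, D (iota c) = 0).

(** The properties of the norm on the disc of radius [r] on which the estimates
    rely; constants in these estimates must not depend on [r]. *)
Definition gauss_like (r : R) (N : nonarch_absval R F) :=
  (forall c, N (iota c) = v c) /\ (forall x, N (D x) <= N x / r).

(** Let [d] be the point of [B] closest to [x] and [s = N (x - d)]. The other
    factors are at least [t = max e s], where [e <= 1] bounds the distances in
    [B] from below, and [N x] is at most a multiple of [t]. As [N (D x) <= s / r],
    three points suffice: the left side is at most a multiple of
    [s ^ 2 * t / r ^ 2], the product on the right is at least [s * t ^ 2] up to
    a constant. *)
Lemma deriv_bound B : uniq B -> (3 <= size B)%N ->
  exists2 C : R, 0 < C & forall (r : R) N x, 0 < r -> gauss_like r N ->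
    N (D x) ^+ 2 * Num.max 1 (N x) <= C / r ^+ 2 * N (\prod_(d <- B) (x - iota d)).
Proof.
move=> uB B3; have [M M1 hM] := absval_seq_bound B.
have [e /andP[e0 e1] he] := absval_seq_gap B.
have M0 : 0 < M by exact: lt_le_trans M1.
exists (M / e / e ^+ (size B - 3)); first by rewrite !divr_gt0 ?exprn_gt0.
move=> r N x r0 [NC ND].
have [|d dB hd] := @seq_min R _ (fun d => N (x - iota d)) B.
  by case: (B) B3.
set s := N (x - iota d) in hd; pose t := Num.max e s.
have s0 : 0 <= s by exact: absval_ge0.
have et : e <= t by rewrite /t le_max lexx.
have st : s <= t by rewrite /t le_max lexx orbT.
have t0 : 0 < t by exact: lt_le_trans et.
have Nx : Num.max 1 (N x) <= M / e * t.
  have Me1 : 1 <= M / e by rewrite ler_pdivlMr// mul1r (le_trans e1).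
  have Mt : M <= M / e * t by rewrite -mulrA ler_peMr ?(ltW M0)// mulrC ler_pdivlMr// mul1r.
  rewrite ge_max (le_trans M1 Mt)/= -(subrK (iota d) x).
  rewrite (le_trans (absvalD _ _ _))// ge_max NC (le_trans (hM _ dB) Mt) andbT.
  by rewrite -/s (le_trans st)// ler_peMl// ltW.
have NDx : N (D x) <= s / r.
  by have := ND (x - iota d); rewrite derDB// D_const subr0.
have far c : c \in B -> c != d -> t <= N (x - iota c).
  move=> cB cd; rewrite /t ge_max hd// andbT.
  apply: le_trans (he d c dB cB _) _; first by rewrite eq_sym.
  rewrite -NC rmorphB; have -> : iota d - iota c = (x - iota c) - (x - iota d) by ring.
  by rewrite (le_trans (absvalB _ _ _))// ge_max lexx hd.
have prodB : s * t ^+ (size B).-1 <= N (\prod_(d <- B) (x - iota d)).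
  rewrite absval_prod (big_rem d)//= -/s ler_wpM2l// -(size_rem dB).
  have : forall c, c \in rem d B -> t <= N (x - iota c).
    by move=> c; rewrite mem_rem_uniq// inE => /andP[cd cB]; exact: far.
  elim: (rem d B) => [|c l IH] hl; first by rewrite big_nil expr0.
  rewrite big_cons exprS ler_pM ?exprn_ge0 ?(ltW t0)//.
    by apply: hl; rewrite inE eqxx.
  by apply: IH => z zl; apply: hl; rewrite inE zl orbT.
have tk : t ^+ 2 * e ^+ (size B - 3) <= t ^+ (size B).-1.
  (* two factors besides [s] are kept, the others are only at least [e] *)
  have -> : (size B).-1 = (2 + (size B - 3))%N by rewrite -{1}(subnK B3) addnC.
  rewrite exprD ler_wpM2l ?exprn_ge0 ?(ltW t0)//.
  by rewrite lerXn2r ?nnegrE ?(ltW e0) ?(ltW t0).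
apply: (@le_trans _ _ ((s / r) ^+ 2 * (M / e * t))).
  apply: ler_pM; rewrite ?exprn_ge0 ?absval_ge0 ?le_max ?ler01//.
  by rewrite lerXn2r ?nnegrE ?absval_ge0 ?divr_ge0 ?(ltW r0).
apply: (@le_trans _ _ (M / e / e ^+ (size B - 3) / r ^+ 2 * (s * (t ^+ 2 * e ^+ (size B - 3))))).
  have -> : M / e / e ^+ (size B - 3) / r ^+ 2 * (s * (t ^+ 2 * e ^+ (size B - 3))) =
      (M / e * t) * (s * t) / r ^+ 2.
    by field; rewrite ?expf_neq0 ?gt_eqF.
  have -> : (s / r) ^+ 2 * (M / e * t) = (M / e * t) * (s * s) / r ^+ 2.
    by field; rewrite ?gt_eqF.
  rewrite ler_wpM2r ?invr_ge0 ?exprn_ge0 ?(ltW r0)// ler_wpM2l ?ler_wpM2l//.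
  by rewrite mulr_ge0 ?(ltW t0)// divr_ge0 ?ltW.
have C0 : 0 <= M / e / e ^+ (size B - 3) / r ^+ 2.
  by rewrite !divr_ge0 ?exprn_ge0 ?(ltW r0) ?(ltW e0) ?(ltW M0).
rewrite ler_wpM2l//; apply: le_trans prodB; exact: ler_wpM2l.
Qed.

(** If [N x] exceeds all roots of [P] and [1], then the absolute value of [P] at
    [x] is that of its leading term. *)
Lemma same_growth (P : {poly K}) : (1 < size P)%N ->
  exists2 M : R, 1 <= M & forall r N (x y : F), gauss_like r N ->
    (map_poly iota P).[x] = (map_poly iota P).[y] ->
    N x = N y \/ (N x <= M /\ N y <= M).
Proof.
move=> P1; have [s PE] := closed_field_poly_normal P.
have c0 : lead_coef P != 0 by rewrite lead_coef_eq0 -size_poly_gt0 ltnW.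
have s0 : (0 < size s)%N.
  by move: P1; rewrite PE size_scale// size_prod_XsubC ltnS.
have [M M1 hM] := absval_seq_bound s; exists M => // r N x y [NC _] e.
have M0 : 0 <= M by exact: le_trans M1.
have {e} : \prod_(d <- s) N (x - iota d) = \prod_(d <- s) N (y - iota d).
  move: e; rewrite PE !map_poly_factored => /(mulfI _) e.
  by rewrite -!absval_prod e// fmorph_eq0.
have large (z : F) : M < N z -> \prod_(d <- s) N (z - iota d) = N z ^+ size s.
  move=> Mz; rewrite (eq_big_seq (fun=> N z)) => [|d ds].
    by rewrite big_const_seq count_predT iter_mulr_1.
  by rewrite absval_addl// absvalN NC (le_lt_trans (hM _ ds)).
have small (z : F) : N z <= M -> \prod_(d <- s) N (z - iota d) <= M ^+ size s.
  move=> zM; have : forall d, d \in s -> N (z - iota d) <= M.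
    by move=> d ds; rewrite (le_trans (absvalB _ _ _))// ge_max zM NC hM.
  elim: (s) => [|d l IH] hl; first by rewrite big_nil.
  rewrite big_cons exprS ler_pM ?absval_ge0//.
  - by apply: prodr_ge0 => *; exact: absval_ge0.
  - by apply: hl; rewrite inE eqxx.
  by apply: IH => c cl; apply: hl; rewrite inE cl orbT.
have lt z : M < N z -> M ^+ size s < N z ^+ size s.
  by move=> Mz; rewrite ltr_pXn2r ?nnegrE ?absval_ge0.
have [xM|Mx] := leP (N x) M; have [yM|My] := leP (N y) M => e; first by right.
- by have := small x xM; rewrite e large// leNgt lt.
- by have := small y yM; rewrite -e large// leNgt lt.
left; move: e; rewrite !large// => /eqP.
by rewrite eqrXn2 ?absval_ge0// => /eqP.
Qed.

(** By [same_growth] the square of [N (f - g)] is at most a multiple of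
    [max 1 (N f) * max 1 (N g)], and the two factors are absorbed by
    [deriv_bound]. *)
Lemma test_fun_bound (P : {poly K}) B : (1 < size P)%N -> uniq B ->
  (3 <= size B)%N -> exists2 C : R, 0 < C &
  forall (r : R) N (f g : F), 0 < r -> gauss_like r N ->
    nonconstant iota f -> nonconstant iota g ->
    (map_poly iota P).[f] = (map_poly iota P).[g] ->
    N (test_fun iota D B f g) <= C / r ^+ 4.
Proof.
move=> P1 uB B3; have [C C0 hC] := deriv_bound uB B3.
have [M M1 hM] := same_growth P1; exists (C ^+ 2 * M ^+ 2).
  by rewrite mulr_gt0 ?exprn_gt0// (lt_le_trans _ M1).
move=> r N f g r0 gN nf ng e.
have hf := hC r N f r0 gN; have hg := hC r N g r0 gN.
have Nprod x : nonconstant iota x -> 0 < N (\prod_(d <- B) (x - iota d)).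
  by move=> nx; rewrite absval_gt0 prod_sub_neq0.
move: (Nprod f nf) (Nprod g ng) => pf pg.
rewrite /test_fun absval_div absvalX !absvalM.
set a := N (D f) in hf *; set b := N (D g) in hg *.
move: pf pg hf hg; set p := N (\prod_(d <- B) (f - _)).
set q := N (\prod_(d <- B) (g - _)) => p0 q0 hf hg.
have M0 : 0 < M by exact: lt_le_trans M1.
have hfg : N (f - g) ^+ 2 <= M ^+ 2 * (Num.max 1 (N f) * Num.max 1 (N g)).
  have m1 (x : R) : 1 <= Num.max 1 x by rewrite le_max lexx.
  have Nf0 := absval_ge0 N f; have Ng0 := absval_ge0 N g.
  have Nfg := absvalB N f g; have Nfg0 := absval_ge0 N (f - g).
  have [fg|[fM gM]] := hM r N f g gN e.
    apply: (@le_trans _ _ (1 * (N f * N g))).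
      move: Nfg; rewrite fg maxxx mul1r => h.
      by rewrite expr2 ler_pM.
    apply: ler_pM; rewrite ?mulr_ge0 ?exprn_ege1//.
    by rewrite ler_pM// le_max lexx orbT.
  apply: (@le_trans _ _ (M ^+ 2 * 1)).
    rewrite mulr1 lerXn2r ?nnegrE ?(ltW M0)// (le_trans Nfg)//.
    by rewrite ge_max fM gM.
  by rewrite ler_wpM2l ?exprn_ge0 ?(ltW M0)// mulr_ege1.
rewrite ler_pdivrMr ?mulr_gt0//.
have a0 : 0 <= a by exact: absval_ge0.
have b0 : 0 <= b by exact: absval_ge0.
apply: (@le_trans _ _ ((a * b) ^+ 2 * (M ^+ 2 * (Num.max 1 (N f) * Num.max 1 (N g))))).
  by rewrite exprMn ler_wpM2l// exprn_ge0// mulr_ge0.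
have -> : (a * b) ^+ 2 * (M ^+ 2 * (Num.max 1 (N f) * Num.max 1 (N g))) =
  M ^+ 2 * ((a ^+ 2 * Num.max 1 (N f)) * (b ^+ 2 * Num.max 1 (N g))) by ring.
have -> : C ^+ 2 * M ^+ 2 / r ^+ 4 * (p * q) =
  M ^+ 2 * ((C / r ^+ 2 * p) * (C / r ^+ 2 * q)) by field; rewrite gt_eqF.
rewrite ler_wpM2l ?exprn_ge0 ?(ltW M0)// ler_pM//.
- by rewrite mulr_ge0 ?exprn_ge0// le_max ler01.
- by rewrite mulr_ge0 ?exprn_ge0// le_max ler01.
Qed.

End Growth.

(** * Columns of critical points *)

Section Columns.
Variables (K : closedFieldType) (K_char0 : [pchar K] =i pred0) (P : {poly K}).

Lemma char0_natr_neq0 n : (n.+1%:R : K) != 0.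
Proof. by rewrite ((pcharf0P K).1 K_char0). Qed.

Lemma infinite_char0 : ~ finite_set [set: K].
Proof.
move=> h; apply: infinite_nat.
apply: (@finite_preimage _ _ _ (fun n : nat => n%:R : K)) h => m n _ _ mn.
wlog lemn : m n mn / (m <= n)%N.
  by move=> h; case/orP: (leq_total m n) => ?; [apply: h|apply/esym/h].
move: mn; rewrite -(subnK lemn); case: (n - m)%N => // k.
rewrite natrD addrC => /eqP; rewrite -subr_eq0 opprD addNKr oppr_eq0.
by rewrite (negPf (char0_natr_neq0 k)).
Qed.

(** A nonempty [crit P] excludes the degenerate case where all points are roots
    of the derivative: the set of roots is then infinite and read as empty. *)
Lemma crit_deriv d : d \in crit P -> P^`() != 0 /\ crit P =i root P^`().
Proof.
rewrite /crit; have [fin|inf] := pselect (finite_set [set d | root P^`() d]%classic).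
  move=> _; split=> [|x]; last first.
    by rewrite in_fset_set//; apply/idP/idP => [/set_mem|/mem_set].
  apply/eqP => P'0; apply: infinite_char0; apply: sub_finite_set fin => x _ /=.
  by rewrite P'0 root0.
by rewrite /fset_set; case: pselect.
Qed.

(** In characteristic zero a derivation lowers the multiplicity of a root by
    one; at a noncritical point both multiplicities are trivial. *)
Lemma value_mult_critmult a : P^`() != 0 -> value_mult P a = (critmult P a).+1.
Proof.
move=> P'0; rewrite /value_mult /critmult; set Q := P - _.
have Q'E : P^`() = Q^`() by rewrite derivB derivC subr0.
have Q0 : Q != 0 by apply: contraNneq P'0 => e; rewrite Q'E e deriv0.
have Qa : root Q a by rewrite rootE !hornerE subrr.
have [m [S Sa QE]] := multiplicity_XsubC Q a; rewrite Q0 /= in Sa.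
case: m QE => [|m] QE; first by move: Qa; rewrite QE mulr1 (negPf Sa).
have mQ : mup a Q = m.+1 by rewrite QE mupMr// mup_XsubCX eqxx.
rewrite mQ Q'E QE derivM deriv_exp derivXsubC mul1r /=; congr _.+1.
have -> : S^`() * ('X - a%:P) ^+ m.+1 + S * (('X - a%:P) ^+ m *+ m.+1) =
    (S^`() * ('X - a%:P) + S *+ m.+1) * ('X - a%:P) ^+ m.
  by rewrite mulrDl exprS mulrA mulrnAl mulrnAr.
rewrite mupMr ?mup_XsubCX ?eqxx//.
rewrite rootE hornerD hornerM hornerXsubC subrr mulr0 add0r hornerMn.
by rewrite -mulr_natr mulf_eq0 negb_or char0_natr_neq0 andbT.
Qed.

(** The multiplicity of [a] occurs once in the column, so [b] has another one. A
    multiplicity of the column that is at least that of [a] exceeds all repeated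
    ones too, so it belongs to [multA_H1] and is bounded by its maximum. *)
Lemma colB_H2_sep (C : {fset K}) a b : a \in colB_H2 P C -> b \in C -> b != a ->
  critmult P b != critmult P a /\ (critmult P b + 1 < 2 * (critmult P a + 1))%N.
Proof.
rewrite !inE /= => /andP[aC]; set q := critmult P a.
rewrite mem_filter => /andP[qmax]; rewrite mem_filter => /andP[/allP qH1].
rewrite mem_filter => /andP[/eqP q1 qC] bC ba.
have bl : critmult P b \in multlist P C by exact: map_f.
have bq : critmult P b != q.
  apply/eqP => e; move: q1; rewrite count_map -size_filter => s1.
  suff : (size [:: a; b] <= size [seq x <- C | preim (critmult P) (pred1 q) x])%N.
    by rewrite s1.
  apply: uniq_leq_size => [|x]; first by rewrite /= inE eq_sym ba.
  by rewrite !inE mem_filter => /orP[] /eqP -> /=; rewrite ?e eqxx.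
split => //; have [qb|] := leqP q (critmult P b); last by lia.
have bA : critmult P b \in multA P C.
  by apply: contraT => bA; have := qH1 _ bl; rewrite bA /= ltnNge qb.
have bH1 : critmult P b \in multA_H1 P C.
  rewrite mem_filter bA andbT; apply/allP => q' q'l; apply/implyP => q'A.
  by have := qH1 _ q'l; rewrite q'A /= => h; apply: leq_trans qb.
have := @leq_bigmax_seq _ (multA_H1 P C) xpredT id _ bH1 isT.
move: qmax; set M := (\max_(_ <- _) _)%N => qmax bM; have {}bM : (critmult P b <= M)%N by exact: bM. by lia.
Qed.

Definition good_points : {fset K} := (\bigcup_(C <- columns P) colB_H2 P C)%fset.

Lemma good_pointsP a : a \in good_points ->
  exists2 c, c \in crit P & a \in colB_H2 P (column P c).
Proof.
move=> /bigfcupP[C /andP[+ _] aC] => /imfsetP[c cP CE]; exists c => //.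
by rewrite -CE.
Qed.

(** Points with the critical value of [a] are in its column if they are
    critical; otherwise their [value_mult] is one, and that of [a] at least
    two. *)
Lemma good_points_separated : separated_values P (enum_fset good_points).
Proof.
move=> a b /good_pointsP[c cP ac] ba Pba.
have [P'0 critE] := crit_deriv cP.
have aC : a \in column P c by move: ac; rewrite !inE => /andP[].
have [aP Pac] : a \in crit P /\ P.[a] == P.[c].
  by move: aC; rewrite !inE => /andP[].
rewrite !value_mult_critmult//.
have [bP|bP] := boolP (root P^`() b).
  have bcrit : b \in crit P by rewrite critE; exact: bP.
  have bC : b \in column P c by rewrite !inE /= bcrit Pba.
  by have [] := colB_H2_sep ac bC ba; lia.
rewrite {1 3}/critmult (mupNroot bP).
have : (0 < critmult P a)%N.
  by rewrite -(XsubC_dvd _ P'0) dvdp_XsubCl; have := critE a; rewrite aP => /esym.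
by lia.
Qed.

Lemma good_points_size : (1 <= tnum' P)%N -> (1 < size P)%N.
Proof.
move=> /[!cardfs_gt0] /fset0Pn[a /good_pointsP[c /crit_deriv[P'0 _] _]].
rewrite ltnNge; apply: contraNN P'0 => /size1_polyC ->.
by rewrite derivC.
Qed.

End Columns.

(** * Uniqueness *)

Section Uniqueness.
Variables (R : realType) (K : closedFieldType) (v : nonarch_absval R K).
Hypotheses (K_char0 : [pchar K] =i pred0) (K_complete : absval_complete v).

(** The residue of a fraction [u / w] is the quotient of the values of [u] and
    [w], with [w] nonzero at [a]. *)
Lemma point_place_geometric a :
  geometric_place (meroC v) (@mero_deriv R K v) (point_place K_complete a).
Proof.
split=> [c c0|x x0 ox|x x0 ox].
- by apply: prime_place_unit; exact: entireXsubC_ndivides_const.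
- have [u [w [pw xE]]] := (prime_ord_ge (entireXsubC_prime K_complete a)
    (@entireXsubC_finite_order _ _ v a) 0 x0).1 ox.
  rewrite expr0z mul1r in xE.
  have [h uE] := evalf_divides_ex K_complete u a.
  have [k wE] := evalf_divides_ex K_complete w a.
  have w0 := ndivides_neq0 pw.
  have b0 : evalf K_complete w a != 0.
    by apply/eqP => /(divides_evalf K_complete).
  move: (evalf _ u a) (evalf _ w a) b0 uE wE => b c c0 uE wE.
  exists (b / c); have [->|ne] := eqVneq x (meroC v (b / c)); [by left|right].
  rewrite -subr_eq0 in ne.
  apply: (prime_ord_ge (entireXsubC_prime K_complete a)
    (@entireXsubC_finite_order _ _ v a) 1 ne).2.
  exists (h * entireC v c - entireC v b * k), (w * entireC v c); split.
    by apply: ndividesM => //; [exact: entireXsubC_prime|exact: entireXsubC_ndivides_const].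
  have C0 : entireC v c != 0.
    by apply: contraTneq c0 => /eqP; rewrite fmorph_eq0 => ->.
  rewrite expr1z xE rmorphM fmorphV /= -mulNr addf_div ?tofrac_eq0//.
  rewrite mulrA -!tofracM; congr (_ / _).
  rewrite -tofracN -tofracM -tofracD; congr (_ %:F); rewrite uE wE.
  by ring.
have nat_ndiv n : ~ divides (entireXsubC v a) n.+1%:R.
  rewrite -(rmorph_nat (entireC v)); apply: entireXsubC_ndivides_const.
  exact: (char0_natr_neq0 K_char0).
exact: (prime_place_deriv (entire_derivation v) (entire_deriv_XsubC v a) nat_ndiv x0 ox).
Qed.

Lemma gauss_absval_gauss_like (r : R) (r0 : 0 < r) :
  gauss_like v (meroC v) (@mero_deriv R K v) r (gauss_absval v r0).
Proof. by split=> [c|x]; [exact: gauss_absval_const|exact: gauss_mero_deriv]. Qed.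

(** On the unit disc the test function is bounded by its norms on larger discs,
    which go to 0. *)
Lemma meromorphic_unique (P : {poly K}) (B : seq K) (f g : meromorphic v) :
  (1 < size P)%N -> uniq B -> separated_values P B -> (3 <= size B)%N ->
  (5 <= size B)%N \/ (forall a, 0 <= point_place K_complete a f) ->
  nonconstant (meroC v) f -> nonconstant (meroC v) g ->
  (map_poly (meroC v) P).[f] = (map_poly (meroC v) P).[g] -> f = g.
Proof.
move=> P1 uB sB B3 hB nf ng e; apply/eqP; apply: contraT => fg.
have D_const := @mero_deriv_const R K v; have derD := mero_derivation v.
have [C C0 hC] := test_fun_bound v derD D_const P1 uB B3.
set W := test_fun (meroC v) (@mero_deriv R K v) B f g in hC.
have W0 : W != 0 := (ord_test_fun derD D_const (point_place_geometric 0) B nf ng fg).1.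
have Wreg a : 0 <= point_place K_complete a W.
  apply: (test_fun_regular derD D_const (point_place_geometric a) P1 nf ng fg e) => //.
  by case: hB => hB; [right|left].
set w := gauss_absval v ltr01 W.
have w0 : 0 < w by rewrite absval_gt0.
(* [r] such that [C / r ^ 4 < w] *)
pose r : R := 1 + C / w.
have Cw : 0 < C / w by exact: divr_gt0.
have r1 : 1 <= r by rewrite /r lerDl ltW.
have r0 : 0 < r by exact: lt_le_trans r1.
have := hC r _ f g r0 (gauss_absval_gauss_like r0) nf ng e.
have := gauss_absval_regular r0 ltr01 r1 W0 Wreg.
move=> /le_trans h /h {h}; rewrite -/w leNgt => /negP[].
rewrite ltr_pdivrMr ?exprn_gt0//.
apply: (@lt_le_trans _ _ (w * r)).
  by rewrite mulrC -ltr_pdivrMr// /r ltrDr.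
by rewrite ler_pM2l// exprS ler_peMr ?(ltW r0)// exprn_ege1.
Qed.

End Uniqueness.

Theorem theorem3p1 (R : realType) (K : closedFieldType)
    (v : nonarch_absval R K) (K_char0 : [pchar K] =i pred0)
    (K_complete : absval_complete v)
    (P : {poly K}) (P_simple : forall x, root P x -> mup x P = 1%N) :
  ((1 <= tnum P)%N -> (5 <= tnum' P)%N -> UPM v P) /\
  ((1 <= tnum P)%N -> (4 <= tnum' P)%N -> UPE v P).
Proof.
have sB := good_points_separated K_char0 (P := P).
have uB := fset_uniq (good_points P).
split=> _ ht; have P1 : (1 < size P)%N.
- by apply: (good_points_size K_char0); exact: leq_trans ht.
- split=> // f g nf ng.
  have B3 : (3 <= size (good_points P))%N by exact: leq_trans ht.
  exact: (meromorphic_unique K_char0 (K_complete := K_complete) P1 uB sB B3 (or_introl ht) nf ng).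
- by apply: (good_points_size K_char0); exact: leq_trans ht.
split=> // f g nf ng e; apply/eqP; rewrite -tofrac_eq; apply/eqP.
have mapE (h : entire v) :
    (map_poly (meroC v) P).[h%:F] = (map_poly (entireC v) P).[h]%:F.
  by rewrite -horner_map /= -map_poly_comp.
have nonconst (h : entire v) : ~ (exists c, h = entireC v c) ->
    nonconstant (meroC v) h%:F.
  by move=> nh [c /eqP]; rewrite tofrac_eq => /eqP hc; apply: nh; exists c.
apply: (meromorphic_unique K_char0 (K_complete := K_complete) P1 uB sB) => //.
- exact: leq_trans ht.
(* entire functions have no pole *)
- right=> a; have [f0|f0] := eqVneq f 0; last exact: prime_place_tofrac.
  by case: nf; exists 0; rewrite rmorph0.
- exact: nonconst.
- exact: nonconst.
by rewrite !mapE e.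
Qed.
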